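(* Let $(X,d)$ be an extended metric space and $I=(0,T)\subset\mathbb{R}$ with $0<T<\infty$. Let $\gamma\in L^0(I;X)$. Then the following are equivalent: (1) $\mathrm{ess\,Var}^*(\gamma)<+\infty$; (2) $\displaystyle\sup_{0<h<T}\int_0^{T-h}\frac{d(\gamma_{t+h},\gamma_t)}{h}\,\mathrm{d}t<+\infty$; (3) there exists a finite Borel measure $\mu\in\mathcal{M}^+(I)$ such that for all $\varphi\in\mathrm{Lip}_1(X,d)$, the function $\varphi\circ\gamma$ is a BV-function and $|\mathrm{D}(\varphi\circ\gamma)|\le\mu$; (4) there exists a finite Borel measure $\mu\in\mathcal{M}^+(I)$ such that $d(\gamma_s,\gamma_t)\le\mu([s,t])$ for $\mathcal{L}^2$-almost every $(s,t)\in I^2$ with $s\le t$. If, in addition, $(X,d)$ is complete, these are also equivalent to: (5) $\gamma$ is a BV-curve, i.e. $\mathrm{ess\,Var}(\gamma;I)<+\infty$; and (in this case) $\gamma$ admits a càdlàg representative $\tilde\gamma$ such that $\mathrm{ess\,Var}(\gamma;(a,b))=\mathrm{Var}(\tilde\gamma;(a,b))$ for all $(a,b)\subseteq I$.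
   Context: An extended metric space is a set with a distance satisfying the metric axioms but allowed to take the value $+\infty$; its topology is the one generated by the balls of finite radius. $L^0(I;X)$ is the set of Borel maps $I\to X$ modulo $\mathcal{L}^1$-a.e. equality. For $\gamma:J\to X$ with $J\subset I$ and $A\subset J$, $\mathrm{Var}(\gamma;A)=\sup\sum_{i=0}^k d(\gamma_{t_i},\gamma_{t_{i+1}})$ over finite increasing $t_0<\dots<t_{k+1}$ in $A$; $\mathrm{Var}(\gamma)=\mathrm{Var}(\gamma;J)$. For $A\subset I$, $\mathrm{ess\,Var}(\gamma;A)=\inf\{\mathrm{Var}(\tilde\gamma;A):\tilde\gamma=\gamma\text{ a.e. on }A\}$ (with $\tilde\gamma$ $X$-valued and defined everywhere). The modified essential variation is $$\mathrm{ess\,Var}^*(\gamma)=\inf\{\mathrm{Var}(\tilde\gamma):\ \tilde\gamma:\tilde I\to X,\ \tilde I\subset I,\ \mathcal{L}^1(I\setminus\tilde I)=0,\ \tilde\gamma_t=\gamma_t\ \forall t\in\tilde I\}.$$ $\mathrm{Lip}_1(X,d)$ is the set of $\varphi:X\to\mathbb{R}$ with $|\varphi(x)-\varphi(y)|\le d(x,y)$ for all $x,y$. A real function $u$ on $I$ is a BV-function if $\mathrm{ess\,Var}(u;I)<\infty$ (equivalently $u\in L^1(I)$ and its distributional derivative is a finite signed measure), and $|\mathrm{D}u|$ is the total variation measure of its distributional derivative. Càdlàg means right-continuous with left limits. *)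

(* Defs.v *)
From HB Require Import structures.
From mathcomp Require Import all_boot all_order all_algebra.
From mathcomp Require Import all_classical all_reals all_analysis.
Set Implicit Arguments.
Unset Strict Implicit.
Unset Printing Implicit Defensive.
Import Order.TTheory GRing.Theory Num.Theory.
Import numFieldNormedType.Exports.
Local Open Scope classical_set_scope.
Local Open Scope ring_scope.
Local Open Scope ereal_scope.

(* The analogue of [metricType] for a distance that may take the value +oo.
   The topology and the uniformity are those of the pseudometric structure, so
   [ballE_extdist] says that they are generated by the balls of finite radius. *)
HB.mixin Record PseudoMetric_isExtMetric (R : realType) X
    & PseudoMetric R X := {
  extdist : X -> X -> \bar R ;
  extdist_ge0 : forall x y, 0 <= extdist x y ;
  extdist_eq0 : forall x y, extdist x y = 0 <-> x = y ;
  extdist_sym : forall x y, extdist x y = extdist y x ;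
  extdist_triangle : forall y x z,
    extdist x z <= extdist x y + extdist y z ;
  ballE_extdist : forall x (r : R), ball x r = [set y | extdist x y < r%:E]
}.

#[short(type="extMetricType")]
HB.structure Definition ExtMetric (R : realType) :=
  { X of PseudoMetric R X & PseudoMetric_isExtMetric R X }.

(* Any distance satisfying the axioms gives an [extMetricType]. *)
HB.factory Record isExtMetric (R : realType) X & Choice X := {
  extdist : X -> X -> \bar R ;
  extdist_ge0 : forall x y, 0 <= extdist x y ;
  extdist_eq0 : forall x y, extdist x y = 0 <-> x = y ;
  extdist_sym : forall x y, extdist x y = extdist y x ;
  extdist_triangle : forall y x z,
    extdist x z <= extdist x y + extdist y z
}.

HB.builders Context R X & isExtMetric R X.

Let ball (x : X) (r : R) : set X := [set y | extdist x y < r%:E].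

Let ent : set_system (X * X) := entourage_ ball.

Let nbhs (x : X) : set_system X := nbhs_ ent x.

Let nbhsE : nbhs = nbhs_ ent. Proof. by []. Qed.

HB.instance Definition _ := hasNbhs.Build X nbhs.

Let ball_center x (r : R) : (0 < r)%R -> ball x r x.
Proof. by move=> r0; rewrite /ball/= (extdist_eq0 x x).2// lte_fin. Qed.

Let ball_sym x y (r : R) : ball x r y -> ball y r x.
Proof. by rewrite /ball/= extdist_sym. Qed.

Let ball_triangle x y z (r1 r2 : R) :
  ball x r1 y -> ball y r2 z -> ball x (r1 + r2)%R z.
Proof.
rewrite /ball/= => xy yz.
by rewrite (le_lt_trans (extdist_triangle y _ _))// EFinD lteD.
Qed.

Let entourageE : ent = entourage_ ball. Proof. by []. Qed.

HB.instance Definition _ := @Nbhs_isPseudoMetric.Build R X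
  ent nbhsE ball ball_center ball_sym ball_triangle entourageE.

Let ballE x (r : R) :
  pseudometric_structure.ball x r = [set y | extdist x y < r%:E].
Proof. by []. Qed.

HB.instance Definition _ := PseudoMetric_isExtMetric.Build R X
  extdist_ge0 extdist_eq0 extdist_sym extdist_triangle ballE.

HB.end.

(* The distance is a parameter so that the same definitions apply to X-valued
   curves and to real functions. *)
Section variation.
Context {R : realType} {X : Type} (d : X -> X -> \bar R).
Implicit Types (gam g : R -> X) (A I J : set R) (s : seq R).

Definition polygonal_length gam s : \bar R :=
  \sum_(i < (size s).-1) d (gam s`_i) (gam s`_i.+1).

(* Sequences with at most one point have length 0: a set without two distinct
   points has variation 0 (supremum of the empty family in [0, +oo]). *)
Definition Var gam A : \bar R :=
  ereal_sup [set polygonal_length gam s |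
    s in [set s | sorted <%R s /\ [set` s] `<=` A]].

Definition ess_Var gam A : \bar R :=
  ereal_inf [set Var g A |
    g in [set g | {ae lebesgue_measure, forall t, A t -> g t = gam t}]].

(* A curve defined on J only is a total function of which only the values on J
   matter, since [Var g J] does not depend on the others. *)
Definition ess_Var_star gam I : \bar R :=
  ereal_inf [set v | exists J g,
    [/\ J `<=` I, lebesgue_measure.-negligible (I `\` J),
        forall t, J t -> g t = gam t & v = Var g J]].

End variation.

Section curves.
Context {R : realType} {X : extMetricType R}.
Implicit Types (gam g : R -> X) (I : set R).

Definition Borel_map I gam :=
  forall B : set X, <<s (@open X) >> B -> measurable (I `&` gam @^-1` B).

Definition Lip1 : set (X -> R) :=
  [set phi | forall x y, `|phi x - phi y|%:E <= extdist x y].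

Definition seq_complete := forall u : nat -> X,
  cauchy (u @ \oo) -> exists x : X, u @ \oo --> x.

Definition cadlag I gam := forall t, I t ->
  gam s @[s --> t^'+] --> gam t /\
  exists l : X, gam s @[s --> t^'-] --> l.

Definition representative I gam g :=
  Borel_map I g /\ {ae lebesgue_measure, forall t, I t -> g t = gam t}.

End curves.
Arguments seq_complete {R} X.

Section BV_functions.
Context {R : realType}.
Implicit Types (I : set R) (u phi : R -> R).

Definition BV_function I u :=
  ess_Var (fun x y : R => `|x - y|%:E) u I < +oo.

Definition test_function I phi :=
  (forall n t, derivable (derive1n n phi) t 1) /\
  exists K : set R, [/\ compact K, K `<=` I & forall t, ~ K t -> phi t = 0%R].

Definition charge_integral (nu : {charge set (measurableTypeR R) -> \bar R})
    (P N : set (measurableTypeR R)) (nuPN : hahn_decomposition nu P N)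
    I phi : \bar R :=
  \int[jordan_pos nuPN]_(t in I) (phi t)%:E -
  \int[jordan_neg nuPN]_(t in I) (phi t)%:E.

(* D u = nu as distributions on I. Measures on I are represented by measures on
   the line, of which only the restriction to I is ever used; that of nu is
   determined by u, and does not depend on the Hahn decomposition. *)
Definition distr_derivative I u
    (nu : {charge set (measurableTypeR R) -> \bar R})
    (P N : set (measurableTypeR R)) (nuPN : hahn_decomposition nu P N) :=
  lebesgue_measure.-integrable I (EFin \o u) /\
  forall phi, test_function I phi ->
    \int[lebesgue_measure]_(t in I) (u t * derive1 phi t)%:E =
    - charge_integral nuPN I phi.

(* |D u| <= mu as measures on I. *)
Definition derivative_variation_le I u
    (mu : {finite_measure set (measurableTypeR R) -> \bar R}) :=
  exists (nu : {charge set (measurableTypeR R) -> \bar R})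
         (P N : set (measurableTypeR R)) (nuPN : hahn_decomposition nu P N),
    distr_derivative I u nuPN /\
    forall A : set (measurableTypeR R), measurable A -> A `<=` I ->
      charge_variation nuPN A <= mu A.

End BV_functions.

(* Main.v *)
(* With I = (0, T), the pivot of all the equivalences is: there is a bounded
   nondecreasing F such that d(gam_s, gam_t) <= F t - F s for all s < t in I
   outside a null set ([strong_bv]). For (1), F is the variation of the
   representative up to time t, for (4) twice the distribution function of mu,
   and conversely mu is the Lebesgue-Stieltjes measure of F.

   From (2) or (3) one only gets a function F such that, for every bounded
   1-Lipschitz phi, the inequality |phi (gam_s) - phi (gam_t)| <= F t - F s holds
   outside a null set that depends on phi ([weak_bv]). For (2), F t is the
   supremum of the sums of increments |phi_i (gam_(t_i)) - phi_i (gam_(s_i))|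
   over disjoint intervals on the left of t whose endpoints are Lebesgue points
   of phi_i \o gam, the functions phi_i being arbitrary; difference quotients
   over disjoint intervals add up, so (2) bounds these sums. For (3), F is the
   distribution function of mu, by testing with smoothed indicators of [s, t].

   To make the null set independent of phi, it suffices to show that gam is
   separably valued up to a null set: then countably many truncated distance
   functions are enough. As X is arbitrary, the centre of a ball of radius delta
   containing gam_t is chosen as the first one for a well-order of the
   parameters. On pieces where points with different centres are uniformly far
   apart, the truncated distance to any union of fibres of the centre map shows
   that the union or its complement is null; the centres being indexed by real
   numbers, one fibre carries the whole piece.

   If X is complete, gam has limits from the right and from the left along the
   complement of the null set, and the right limits form the cadlag
   representative. *)
Require Import Defs.
From HB Require Import structures.
From mathcomp Require Import all_boot all_order all_algebra.
From mathcomp Require Import all_classical all_reals all_analysis.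
From mathcomp Require Import wochoice measurable_realfun lra ring.
Import Order.TTheory GRing.Theory Num.Theory.
Import numFieldNormedType.Exports.
Set Implicit Arguments.
Unset Strict Implicit.
Unset Printing Implicit Defensive.
Local Open Scope classical_set_scope.
Local Open Scope ring_scope.
Local Open Scope ereal_scope.

(** * Right limits of monotone functions *)

Section right_limits.
Context {R : realType}.
Implicit Types (F f g : R -> R) (x y : R).
Local Open Scope ring_scope.

Definition rlim F x : R := lim (F y @[y --> x^'+]).

Lemma cvg_rlim F x : {homo F : x y / x <= y} -> F y @[y --> x^'+] --> rlim F x.
Proof.
move=> ndF; apply: nondecreasing_at_right_is_cvgr.
  by near=> z => u v _ _; exact: ndF.
near=> z; exists (F x) => _ /= [u + <-].
by rewrite in_itv/= => /andP[xu _]; apply/ndF/ltW.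
Unshelve. all: by end_near. Qed.

Lemma le_rlim F x : {homo F : x y / x <= y} -> F x <= rlim F x.
Proof.
move=> ndF; apply: limr_ge; first exact: cvg_rlim.
by near=> y; apply: ndF; near: y; exact: nbhs_right_ge.
Unshelve. all: by end_near. Qed.

Lemma rlim_le F x y : {homo F : x y / x <= y} -> x < y -> rlim F x <= F y.
Proof.
move=> ndF xy; apply: limr_le; first exact: cvg_rlim.
by near=> z; apply: ndF; near: z; exact: nbhs_right_le.
Unshelve. all: by end_near. Qed.

Lemma rlim_nd F : {homo F : x y / x <= y} -> {homo rlim F : x y / x <= y}.
Proof.
move=> ndF x y; rewrite le_eqVlt => /predU1P[->//|xy].
by rewrite (le_trans (rlim_le ndF xy))// le_rlim.
Qed.

Lemma rlim_right_continuous F x : {homo F : x y / x <= y} ->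
  rlim F y @[y --> x^'+] --> rlim F x.
Proof.
move=> ndF; apply/cvgrPdist_le => /= e e0.
have /cvgrPdist_le/(_ _ e0) := cvg_rlim (x := x) ndF => -[d /= d0 Hd].
near=> y; have xy : x < y by near: y; exact: nbhs_right_gt.
rewrite ler0_norm ?opprB; last by rewrite subr_le0 rlim_nd// ltW.
have xd : y < x + d / 2 by near: y; apply: nbhs_right_lt; rewrite ltrDl divr_gt0.
have xd2 : x < x + d / 2 by rewrite ltrDl divr_gt0.
have := Hd (x + d / 2); rewrite /= opprD addNKr normrN ger0_norm ?divr_ge0 ?(ltW d0)//.
have -> : d / 2 < d by rewrite ltr_pdivrMr// ltr_pMr// ltr1n.
move=> /(_ erefl xd2); rewrite ler0_norm ?opprB; last first.
  by rewrite subr_le0 rlim_le.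
by apply: le_trans; rewrite lerB// rlim_le.
Unshelve. all: by end_near. Qed.

Lemma rlimD f g x : {homo f : x y / x <= y} -> {homo g : x y / x <= y} ->
  rlim (fun z => f z + g z) x = rlim f x + rlim g x.
Proof.
move=> ndf ndg; apply/cvg_lim; first exact: Rhausdorff.
by apply: cvgD; exact: cvg_rlim.
Qed.

(* The intervals [(f x, g x)] are pairwise disjoint, hence countably many are
   nonempty. *)
Lemma countable_neq_monotone f g : (forall x, f x <= g x) ->
  (forall x y, x < y -> g x <= f y) -> countable [set x | f x != g x].
Proof.
move=> fg gf.
have q x : {q : rat | f x != g x -> f x < ratr q < g x}.
  apply: cid; case: (boolP (f x == g x)) => fgx; first by exists 0.
  have : f x < g x by rewrite lt_neqAle fgx fg.
  by move=> /rat_in_itvoo[q]; rewrite in_itv/= => ?; exists q.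
apply/countable_injP; exists (fun x => pickle (sval (q x))).
move=> x y; rewrite !inE /= => /(svalP (q x))/andP[fp pg].
move=> /(svalP (q y))/andP[fq qg] /(pcan_inj pickleK) pq; rewrite pq in fp pg.
apply/eqP; rewrite eq_le !leNgt.
apply/andP; split; apply/negP => /gf; apply/negP; rewrite -ltNge.
  exact: lt_trans fp qg.
exact: lt_trans fq pg.
Qed.

End right_limits.

(** * Stieltjes measures of bounded monotone functions *)

Section monotone_measure.
Context {R : realType}.
Implicit Types F : R -> R.
Local Notation mu := (@lebesgue_measure R).

(** The jumps of [F] are countable, so at almost every time [F] may be exchanged with its
    right-continuous modification. *)
Lemma negligible_neq_rlim F : {homo F : x y / (x <= y)%R} ->
  mu.-negligible [set x | F x != rlim F x].
Proof.
move=> ndF; set A := [set _ | _].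
have cA : countable A.
  apply: countable_neq_monotone => [x|x y]; first exact: le_rlim.
  exact: rlim_le.
exists A; split => //; last exact: countable_lebesgue_measure0.
by apply: countable_measurable => //; exact: measurable_set1.
Qed.

(* The Lebesgue-Stieltjes measure of the right-continuous modification. *)
Lemma exists_monotone_measure F (C : R) : {homo F : x y / (x <= y)%R} ->
  (forall x, 0 <= F x <= C)%R ->
  exists m : {finite_measure set (measurableTypeR R) -> \bar R},
    forall a b, (a <= b)%R -> m `]a, b]%classic = (rlim F b - rlim F a)%:E.
Proof.
move=> ndF bF.
pose G : cumulative R R := HB.pack (rlim F)
  (isCumulative.Build R _ R (rlim F) (rlim_nd ndF)
    (fun x => rlim_right_continuous (x := x) ndF)).
pose l := lebesgue_stieltjes_measure G.
have lE a b : (a <= b)%R -> l `]a, b]%classic = (rlim F b - rlim F a)%:E.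
  move=> ab; rewrite /l /lebesgue_stieltjes_measure.
  rewrite /measure_extension measurable_mu_extE/=; last exact: is_ocitv.
  by rewrite wlength_itv_bnd.
have lT : l setT <= C%:E.
  rewrite -(bigcup_itvT false false).
  pose I n : set R := `](- n%:R)%R, n%:R%R]%classic.
  have cI : (l \o I) n @[n --> \oo] --> l (\bigcup_n I n).
    apply: nondecreasing_cvg_mu; rewrite /I//; first exact: bigcup_measurable.
    by move=> *; apply/subsetPset/subset_itv; rewrite leBSide/= ?lerN2 ler_nat.
  rewrite -(cvg_lim _ cI)//; apply: lime_le.
    by apply/cvg_ex; exists (l (\bigcup_n I n)).
  apply: nearW => n; rewrite /= lE ?ge0_cp// lee_fin lerBlDr.
  (* The bounds on [F] pass to right limits through nearby values: [rlim F n] is at most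
     [F (n + 1)], and [rlim F (- n)] is at least [F (- n)]. *)
  rewrite (le_trans (rlim_le (y := (n%:R + 1)%R) ndF _)) ?ltrDl//.
  have /andP[_ /le_trans->//] := bF (n%:R + 1)%R; rewrite lerDl.
  have /andP[+ _] := bF (- n%:R)%R; move=> /le_trans; apply; exact: le_rlim.
have lfin : fin_num_fun l.
  move=> A mA; rewrite ge0_fin_numE//; apply: le_lt_trans (ltry C).
  by rewrite (le_trans _ lT)// le_measure// inE.
pose m : {finite_measure set (measurableTypeR R) -> \bar R} :=
  HB.pack l (Measure_isFinite.Build _ _ _ l lfin).
by exists m.
Qed.

(** Half-open intervals are stable under intersection and generate the Borel sets, and the line is a
    countable union of such intervals of finite measure: the uniqueness theorem for measures
    applies. *)
Lemma eq_finite_measure_ocitv (m1 m2 : {measure set (measurableTypeR R) -> \bar R}) :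
  (forall a b, (a <= b)%R -> m1 `]a, b]%classic = m2 `]a, b]%classic) ->
  (forall a b, (a <= b)%R -> m1 `]a, b]%classic < +oo) ->
  forall A, measurable A -> m1 A = m2 A.
Proof.
move=> m12 m1fin A mA.
apply: (@measure_unique _ R (measurableTypeR R) (@ocitv R)
  (fun n => `](- n%:R)%R, n%:R%R]%classic)) => //.
- exact: ocitvI.
- by move=> n; exact: is_ocitv.
- exact: (@bigcup_itvT R false false).
- by move=> B /ocitvP[->|[[a b]/= /ltW ab ->]]; [rewrite !measure0|exact: m12].
- by move=> k; apply: m1fin; rewrite ge0_cp.
Qed.

End monotone_measure.

(** * Variation and monotone bounds on increments *)

Section increments.
Context {R : realType} {X : Type} (d : X -> X -> \bar R).
Implicit Types (gam g : R -> X) (A I : set R) (F : R -> R) (s t : R).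
Local Notation mu := (@lebesgue_measure R).

Definition increment_le gam A F := forall s t, A s -> A t -> (s < t)%R ->
  d (gam s) (gam t) <= (F t - F s)%:E.

Definition ae_increment_le gam I F :=
  exists2 N, mu.-negligible N & increment_le gam (I `\` N) F.

Definition bounded_monotone F (C : R) :=
  {homo F : x y / (x <= y)%R} /\ forall x, (0 <= F x <= C)%R.

Lemma polygonal_length_cons g x y (s : seq R) :
  polygonal_length d g [:: x, y & s] =
  d (g x) (g y) + polygonal_length d g (y :: s).
Proof. by rewrite /polygonal_length/= big_ord_recl. Qed.

Lemma polygonal_length_rcons g x (s : seq R) y :
  polygonal_length d g (x :: rcons s y) =
  polygonal_length d g (x :: s) + d (g (last x s)) (g y).
Proof.
elim: s x => [|z s IH] x /=.
  by rewrite polygonal_length_cons /polygonal_length/= !big_ord0 addeC.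
by rewrite !polygonal_length_cons IH addeA.
Qed.

(** The bounds on the increments telescope along the chain. *)
Lemma polygonal_length_le g A F x (s : seq R) : increment_le g A F ->
  path <%R x s -> [set` x :: s] `<=` A ->
  polygonal_length d g (x :: s) <= (F (last x s) - F x)%:E.
Proof.
move=> gF; elim: s x => [|y s IH] x /=.
  by rewrite /polygonal_length/= big_ord0 subrr.
move=> /andP[xy ys] xysA; rewrite polygonal_length_cons.
have -> : (F (last y s) - F x)%:E = (F y - F x)%:E + (F (last y s) - F y)%:E.
  by rewrite -EFinD; congr (_%:E); lra.
apply: leeD; last by apply: IH => // z zs; apply: xysA; rewrite /= in_cons zs orbT.
by apply: gF => //; apply: xysA; rewrite /= !in_cons eqxx ?orbT.
Qed.

Lemma polygonal_length_le_Var g A (s : seq R) : sorted <%R s -> [set` s] `<=` A ->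
  polygonal_length d g s <= Var d g A.
Proof. by move=> ss sA; apply: ereal_sup_ubound; exists s. Qed.

Lemma Var_ge0 g A : 0 <= Var d g A.
Proof.
have := @polygonal_length_le_Var g A [::] isT.
by rewrite {1}/polygonal_length/= big_ord0; apply.
Qed.

Lemma le_Var g A B : A `<=` B -> Var d g A <= Var d g B.
Proof.
move=> AB; apply: ge_ereal_sup => _ [s [ss sA] <-].
by apply: polygonal_length_le_Var => //; exact: subset_trans AB.
Qed.

Lemma Var_le g A F (C : R) : bounded_monotone F C -> increment_le g A F ->
  Var d g A <= C%:E.
Proof.
move=> [ndF bF] gF; apply: ge_ereal_sup => _ [[|x s] [ss sA] <-].
  rewrite /polygonal_length/= big_ord0 lee_fin.
  by have /andP[] := bF 0%R; exact: le_trans.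
apply: le_trans (polygonal_length_le gF ss sA) _; rewrite lee_fin lerBlDr.
have /andP[F0 _] := bF x; have /andP[_ FC] := bF (last x s).
by rewrite (le_trans FC)// lerDl.
Qed.

Hypothesis d_ge0 : forall x y, 0 <= d x y.

(** Any chain up to [s] can be prolonged by [s] and [t]. This makes the variation up to time [t] a
    monotone function that bounds the increments. *)
Lemma Var_increment g A s t : A s -> A t -> (s < t)%R ->
  Var d g (A `&` `]-oo, s]) + d (g s) (g t) <= Var d g (A `&` `]-oo, t]).
Proof.
move=> As At st; have st' := ltW st.
have dV : d (g s) (g t) <= Var d g (A `&` `]-oo, t]).
  have := @polygonal_length_le_Var g (A `&` `]-oo, t]) [:: s; t].
  rewrite /= st polygonal_length_cons {1}/polygonal_length big_ord0 adde0.
  apply => // z /=; rewrite !in_cons in_nil orbF => /orP[] /eqP->.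
    by split => //=; rewrite in_itv/=.
  by split => //=; rewrite in_itv/=.
(* An infinite distance cannot be moved across the inequality, but then the chain made of [s] and
   [t] already has infinite length. *)
have [dfin|] := boolP (d (g s) (g t) \is a fin_num); last first.
  rewrite ge0_fin_numE// -leNgt leye_eq => /eqP dy.
  by move: dV; rewrite dy leye_eq => /eqP ->; rewrite leey.
rewrite -leeBrDr//; apply: ge_ereal_sup => _ [[|x u] [us uA] <-].
  by rewrite {1}/polygonal_length/= big_ord0 leeBrDr// add0e.
rewrite leeBrDr//; set l := last x u; move: us => /= us.
have [ul ls] : [set` x :: u] l /\ (l <= s)%R.
  have ul : [set` x :: u] l by rewrite /= mem_last.
  by split => //; have [_] := uA _ ul; rewrite /= in_itv.
have uAt z : z \in x :: u -> (A `&` `]-oo, t]%classic) z.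
  move=> /uA[Az /=]; rewrite in_itv/= => zs.
  by split => //=; rewrite in_itv/= (le_trans zs).
have tA : (A `&` `]-oo, t]%classic) t by split => //=; rewrite in_itv/=.
have sA : (A `&` `]-oo, t]%classic) s by split => //=; rewrite in_itv/=.
have subA v : [set` v] `<=` A `&` `]-oo, t] -> forall z, (A `&` `]-oo, t]) z ->
    [set` rcons v z] `<=` A `&` `]-oo, t].
  by move=> vA z zA w /=; rewrite mem_rcons in_cons => /predU1P[->|/vA].
(* If the chain ends at [s], only [t] is appended; otherwise [s] is inserted first, which cannot
   shorten the chain because [d] is nonnegative. *)
move: ls; rewrite le_eqVlt => /predU1P[ls|ls].
  rewrite -{1}ls -polygonal_length_rcons; apply: polygonal_length_le_Var.
    by rewrite /= rcons_path us/= -/l ls.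
  exact: (subA (x :: u)).
apply: (@le_trans _ _ (polygonal_length d g (x :: rcons (rcons u s) t))).
  rewrite polygonal_length_rcons last_rcons leeD2r// polygonal_length_rcons.
  by rewrite leeDl.
apply: polygonal_length_le_Var.
  by rewrite /= !rcons_path us/= -/l ls last_rcons.
by apply: (subA (x :: rcons u s)) => //; exact: (subA (x :: u)).
Qed.

Lemma ess_Var_star_ltyP gam I : ess_Var_star d gam I < +oo <->
  exists F C, bounded_monotone F C /\ ae_increment_le gam I F.
Proof.
split=> [|[F [C [bF [N N0 gF]]]]].
  move=> /ereal_inf_lt[_ [J [g [JI J0 gE ->]]] VJ].
  have Vfin t : Var d g (J `&` `]-oo, t]) \is a fin_num.
    rewrite ge0_fin_numE ?Var_ge0//; apply: le_lt_trans VJ.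
    by apply: le_Var => z [].
  exists (fun t => fine (Var d g (J `&` `]-oo, t]))), (fine (Var d g J)); split.
    split=> [x y xy|x].
      rewrite fine_le//; apply: le_Var => z [Jz /=]; rewrite !in_itv/= => zx.
      by split => //=; rewrite ?in_itv/= (le_trans zx).
    rewrite fine_ge0 ?Var_ge0//= fine_le//; last by apply: le_Var => z [].
    by rewrite ge0_fin_numE ?Var_ge0.
  exists (I `\` J) => // s t [Is nJs] [It nJt] st.
  have Js : J s by apply: contrapT => Js; apply: nJs.
  have Jt : J t by apply: contrapT => Jt; apply: nJt.
  have := Var_increment g Js Jt st; rewrite !gE// EFinB !fineK//.
  by rewrite leeBrDl.
(* For the converse, [gam] itself restricted to the complement of [N] is a competitor in the
   infimum. *)
apply: le_lt_trans (ltry C).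
apply: le_trans (Var_le bF gF); apply: ereal_inf_lbound.
exists (I `\` N), gam; split => //.
apply: negligibleS N0 => x [Ix nN]; apply: contrapT => Nx; exact: nN.
Qed.

End increments.

(** * Lower integrals and translations *)

Section lower_integral.
Context d (T : measurableType d) (R : realType).
Variables (mu : {measure set T -> \bar R}) (D : set T) (f g : T -> \bar R).
Hypotheses (mD : measurable D) (mg : measurable_fun D g).
Import HBNNSimple.

(* [f] need not be measurable: for a nonnegative function the integral of the
   library is the lower integral. *)
Lemma ge0_integral_le_lower : (forall x, D x -> 0 <= g x <= f x) ->
  \int[mu]_(x in D) g x <= \int[mu]_(x in D) f x.
Proof.
move=> gf.
have g0 x : D x -> 0 <= g x by move=> /gf/andP[].
have f0 x : D x -> 0 <= f x by move=> /gf/andP[]; exact: le_trans.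
rewrite !ge0_integralE//; apply: le_ereal_sup => _ [h /= hg <-]; exists h => //= x.
apply: (le_trans (hg x)); rewrite /patch; case: ifPn => //.
by rewrite inE => /gf/andP[].
Qed.

(** Each simple function below [f] is measurable and almost everywhere below [g], so monotonicity
    for measurable functions applies to it before the supremum is taken. *)
Lemma ge0_integral_lower_le : (forall x, D x -> 0 <= f x) ->
  (forall x, D x -> 0 <= g x) ->
  {ae mu, forall x, D x -> f x <= g x} ->
  \int[mu]_(x in D) f x <= \int[mu]_(x in D) g x.
Proof.
move=> f0 g0 fg; rewrite (ge0_integralE _ f0).
apply: ge_ereal_sup => _ [h /= hf <-].
rewrite -integralT_nnsfun integral_mkcond [leRHS]integral_mkcond.
apply: ae_ge0_le_integral => //.
- by move=> x _; rewrite patch_setT lee_fin.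
- by rewrite patch_setT; apply/measurable_EFinP.
- by move=> x _; rewrite /patch; case: ifPn => //; rewrite inE => /g0.
- exact/(measurable_restrictT _ _).1.
apply: filterS fg => x fgx _; rewrite patch_setT; apply: (le_trans (hf x)).
by rewrite /patch; case: ifPn => //; rewrite inE.
Qed.

End lower_integral.

Section translation.
Context {R : realType}.
Local Notation mu := (@lebesgue_measure R).

Let transl (h : R) : R -> measurableTypeR R := fun x => (x + h)%R.

Let mtransl h : measurable_fun setT (transl h).
Proof. exact: measurable_funD. Qed.

Let lebesgue_measure_translation h (A : set R) : measurable A ->
  pushforward mu (transl h) A = mu A.
Proof.
move=> mA; apply/esym/lebesgue_measure_unique => //=; first exact: mtransl.
move=> _ _ [[a b]] _ <-.
have -> : pushforward mu (transl h) `]a, b]%classic = mu `](a - h)%R, (b - h)%R]%classic.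
  rewrite /pushforward; congr (mu _); apply/seteqP.
  by split => x /=; rewrite !in_itv/= ltrBlDr lerBrDr.
by rewrite !lebesgue_measure_itv/= !lte_fin ltrD2r -!EFinB opprD opprK addrACA addNr addr0.
Qed.

Lemma lebesgue_measure_preimage_translation h (A : set R) : measurable A ->
  mu ((fun x => x + h)%R @^-1` A) = mu A.
Proof. exact: lebesgue_measure_translation. Qed.

Lemma negligible_preimage_translation h (N : set R) : mu.-negligible N ->
  mu.-negligible ((fun x => x + h)%R @^-1` N).
Proof.
move=> [A [mA A0 NA]]; exists ((fun x => x + h)%R @^-1` A); split.
- by rewrite -[X in measurable X]setTI; exact: mtransl.
- by rewrite lebesgue_measure_preimage_translation.
- by move=> x; exact: NA.
Qed.

Lemma nonnegligible_itv (N : set R) (a b : R) : mu.-negligible N -> (a < b)%R ->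
  exists2 r, (a < r < b)%R & ~ N r.
Proof.
move=> N0 ab; apply: contrapT => Nab.
have : mu.-negligible `]a, b[%classic.
  apply: negligibleS N0 => r /=; rewrite in_itv/= => rab.
  by apply: contrapT => Nr; apply: Nab; exists r.
move=> /negligibleP-/(_ (measurable_itv _)) muab.
have : mu `]a, b[%classic == 0 by apply/eqP.
by rewrite lebesgue_measure_itv/= lte_fin ab -EFinB eqe subr_eq0 gt_eqF.
Qed.

Lemma ge0_integral_translation (D : set R) (f : R -> \bar R) (h : R) :
  measurable D -> measurable_fun D f -> (forall x, D x -> 0 <= f x) ->
  \int[mu]_(x in (fun x => x + h)%R @^-1` D) f (x + h)%R = \int[mu]_(x in D) f x.
Proof.
move=> mD mf f0.
transitivity (\int[mu]_(x in transl h @^-1` D) (f \o transl h) x) => //.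
rewrite -ge0_integral_pushforward//=; [|exact: mtransl|by move=> y /[!inE]; exact: f0].
apply: eq_measure_integral => /=; first exact: mtransl.
by move=> ? A mA AD; rewrite lebesgue_measure_translation.
Qed.

End translation.

(** * Difference quotients of curves with bounded increments *)

Section strong_increments.
Context {R : realType} {X : extMetricType R}.
Variables (T : R) (gam : R -> X).
Let I : set R := `]0%R, T[%classic.
Local Notation mu := (@lebesgue_measure R).

Definition strong_bv := exists F C, bounded_monotone F C /\
  ae_increment_le extdist gam I F.

(** After translation by [h] the integrals of [F (t + h)] and of [F t] cancel except at the two
    ends. What is left on the right is over an interval of length [h], where [F] is at most [C];
    what is left on the left has a favourable sign. *)
Lemma integral_increment_le (F : R -> R) (C h : R) : bounded_monotone F C ->
  (0 < h < T)%R ->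
  \int[mu]_(t in `]0%R, (T - h)%R[%classic) (F (t + h) - F t)%:E <= (h * C)%:E.
Proof.
move=> [ndF bF] /andP[h0 hT].
have F0 x : (0 <= F x)%R by have /andP[] := bF x.
have mF (D : set R) : measurable D -> measurable_fun D (EFin \o F).
  move=> mD; apply/measurable_EFinP; exact: nondecreasing_measurable.
set D := `]0%R, (T - h)%R[%classic; set J := \int[mu]_(t in D) (F t)%:E.
have mD : measurable D by exact: measurable_itv.
have mFh : measurable_fun D (fun t => (F (t + h) - F t)%:E).
  apply/measurable_EFinP/measurable_funB; last exact: nondecreasing_measurable.
  by apply: nondecreasing_measurable => // x y xy; apply: ndF; rewrite lerD2r.
have Jfin : J \is a fin_num.
  rewrite ge0_fin_numE; last by apply: integral_ge0 => x _; rewrite lee_fin.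
  apply: (@le_lt_trans _ _ (\int[mu]_(t in D) (cst C%:E) t)).
    apply: ge0_le_integral => //.
    - by move=> x _; rewrite lee_fin.
    - exact: mF.
    move=> x _ /=.
    by rewrite lee_fin; have /andP[] := bF x.
  rewrite integral_cst//= /D lebesgue_measure_itv/=; case: ifPn => _.
    by rewrite -EFinD -EFinM ltry.
  by rewrite mule0.
(* As [J] is finite, adding it to both sides turns the integral of a difference into a comparison of
   two integrals of [F]. *)
rewrite -(leeD2rE _ _ Jfin) -ge0_integralD//; last 3 first.
- by move=> x _; rewrite lee_fin subr_ge0 ndF// lerDl ltW.
- by move=> x _; rewrite lee_fin.
- exact: mF.
under eq_integral do rewrite -EFinD subrK.
have -> : D = (fun x => x + h)%R @^-1` `]h, T[.
  by apply/seteqP; split => x /=; rewrite !in_itv/= -ltrBlDr subrr -ltrBrDr.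
rewrite (@ge0_integral_translation _ _ (EFin \o F))//; last 2 first.
- exact: mF.
- by move=> x _; rewrite lee_fin.
apply: (@le_trans _ _ (\int[mu]_(t in D `|` `[(T - h)%R, T[%classic) (F t)%:E)).
  apply: ge0_subset_integral => //; first exact: measurableU.
  - by apply: mF; exact: measurableU.
  - by move=> x _; rewrite lee_fin.
  move=> x /=; rewrite /D/= !in_itv/= => /andP[hx xT].
  rewrite xT (lt_trans h0 hx) andbT/=; case: (ltP x (T - h)%R); by [left|right].
rewrite ge0_integral_setU//; last 3 first.
- by apply: mF; exact: measurableU.
- by move=> x _; rewrite lee_fin.
- apply/disj_setPS => x []; rewrite /D/= !in_itv/= => /andP[_ xT] /andP[Tx _].
  by rewrite ltNge Tx in xT.
rewrite addeC leeD2r//.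
apply: (@le_trans _ _ (\int[mu]_(t in `[(T - h)%R, T[%classic) (cst C%:E) t)).
  apply: ge0_le_integral => //.
    - by move=> x _; rewrite lee_fin.
    - exact: mF.
    move=> x _ /=.
  by rewrite lee_fin; have /andP[] := bF x.
rewrite integral_cst//= lebesgue_measure_itv/= lte_fin ltrBlDr ltrDl h0.
by rewrite -EFinB -EFinM lee_fin opprB addrC subrK mulrC.
Qed.

Lemma strong_bv_difference_quotient : strong_bv -> exists C : R, forall h : R, I h ->
  \int[mu]_(t in `]0%R, (T - h)%R[%classic)
     (extdist (gam (t + h)%R) (gam t) * (h^-1)%:E) <= C%:E.
Proof.
move=> [F [C [bF [N N0 gF]]]]; exists C => h; rewrite /I/= in_itv/= => h0T.
have [h0 hT] := andP h0T; have [ndF _] := bF.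
set D := `]0%R, (T - h)%R[%classic.
have mD : measurable D by exact: measurable_itv.
have mFh : measurable_fun D (fun t => (F (t + h) - F t)%:E).
  apply/measurable_EFinP/measurable_funB; last exact: nondecreasing_measurable.
  by apply: nondecreasing_measurable => // x y xy; apply: ndF; rewrite lerD2r.
have F0 x : 0 <= (F (x + h) - F x)%:E by rewrite lee_fin subr_ge0 ndF// lerDl ltW.
apply: (@le_trans _ _ (\int[mu]_(t in D) ((h^-1)%:E * (F (t + h) - F t)%:E))).
  (* The distance is not known to be a measurable function of [t], so the comparison is one of lower
     integrals. *)
  apply: ge0_integral_lower_le => //.
  - exact: measurable_funeM.
  - by move=> x _; rewrite mule_ge0 ?extdist_ge0// lee_fin invr_ge0 ltW.
  - by move=> x _; rewrite mule_ge0// lee_fin invr_ge0 ltW.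
  (* Both [t] and [t + h] have to avoid [N]. *)
  have := negligibleU N0 (negligible_preimage_translation h N0).
  apply: negligibleS => t /= /not_implyP[]; rewrite /D/= in_itv/= => /andP[t0 tT] tF.
  apply: contrapT => /not_orP[Nt Nth]; apply: tF.
  rewrite extdist_sym muleC lee_pmul2l ?lte_fin ?invr_gt0//.
  apply: gF; last by rewrite ltrDl.
  - by split => //; rewrite /I/= in_itv/= t0 (lt_trans tT)// ltrBlDr ltrDl.
  - by split => //; rewrite /I/= in_itv/= addr_gt0//= -ltrBrDr.
rewrite ge0_integralZl//; last by rewrite lee_fin invr_ge0 ltW.
by rewrite lee_pdivrMl// integral_increment_le.
Qed.

End strong_increments.

(** * Bounds by a measure of the interval *)

Section product_characterization.
Context {R : realType} {X : extMetricType R}.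
Variables (T : R) (gam : R -> X).
Let I : set R := `]0%R, T[%classic.
Local Notation mu := (@lebesgue_measure R).

Definition distribution_function (m : set (measurableTypeR R) -> \bar R) (x : R) : R :=
  fine (m `]-oo, x]%classic).

Lemma bounded_monotone_distribution_function
    (m : {finite_measure set (measurableTypeR R) -> \bar R}) :
  bounded_monotone (distribution_function m) (fine (m setT)).
Proof.
have mfin A : measurable A -> m A \is a fin_num by exact: fin_num_measure.
split=> [x y xy|x]; rewrite /distribution_function.
  rewrite fine_le ?mfin// le_measure ?inE// => z /=.
  by rewrite !in_itv/= => /le_trans; apply.
by rewrite fine_ge0//= fine_le ?mfin// le_measure ?inE.
Qed.

Lemma distribution_functionB
    (m : {finite_measure set (measurableTypeR R) -> \bar R}) x y : (x <= y)%R ->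
  m `]x, y]%classic = (distribution_function m y - distribution_function m x)%:E.
Proof.
move=> xy; have mfin A : measurable A -> m A \is a fin_num by exact: fin_num_measure.
rewrite /distribution_function EFinB !fineK ?mfin//.
rewrite -[X in _ = X - _](_ : m (`]-oo, x]%classic `|` `]x, y]%classic) = _).
  rewrite measureU//; first by rewrite addeAC subee ?add0e ?mfin.
  apply/seteqP; split => z //= -[]; rewrite !in_itv/= => zx /andP[+ _].
  by rewrite ltNge zx.
congr (m _); apply/seteqP; split => z /=; rewrite !in_itv/=.
  by move=> [/le_trans|/andP[]]//; apply.
by case: (leP z x) => [|xz zy]; [left|right].
Qed.

(** An atom at [x] is a jump between the masses of the open and of the closed half-line ending at
    [x], and there are only countably many jumps. *)
Lemma negligible_atoms
    (m : {finite_measure set (measurableTypeR R) -> \bar R}) :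
  mu.-negligible [set x | m [set x] != 0].
Proof.
have mfin A : measurable A -> m A \is a fin_num by exact: fin_num_measure.
have [ndF bF] := bounded_monotone_distribution_function m.
set F := distribution_function m in ndF bF.
pose f x := fine (m `]-oo, x[%classic).
have cA : countable [set x | f x != F x].
  apply: countable_neq_monotone => [x|x y xy].
    rewrite fine_le ?mfin// le_measure ?inE// => z /=.
    by rewrite !in_itv/=; exact: ltW.
  rewrite fine_le ?mfin// le_measure ?inE// => z /=.
  by rewrite !in_itv/= => /le_lt_trans; apply.
have : mu.-negligible [set x | f x != F x].
  exists [set x | f x != F x]; split => //; last exact: countable_lebesgue_measure0.
  by apply: countable_measurable => //; exact: measurable_set1.
apply: negligibleS => x /=; apply: contra => /eqP fF.
have : m `]-oo, x]%classic = m `]-oo, x[%classic + m [set x].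
  rewrite -measureU//; last first.
    by apply/seteqP; split => z //= -[]; rewrite in_itv/= => + zx; rewrite zx ltxx.
  congr (m _); apply/seteqP; split => z /=; rewrite !in_itv/=.
    by rewrite le_eqVlt => /predU1P[->|]; [right|left].
  by move=> [/ltW//|->].
have -> : m `]-oo, x]%classic = m `]-oo, x[%classic.
  by rewrite -[LHS]fineK ?mfin// -[RHS]fineK ?mfin// -/(f x) fF.
move=> /(congr1 (fun z => z - m `]-oo, x[%classic)).
by rewrite subee ?mfin// addeAC subee ?mfin// add0e => <-.
Qed.

Lemma strong_bv_product : strong_bv T gam ->
  exists m : {finite_measure set (measurableTypeR R) -> \bar R},
    {ae (mu \x mu), forall p : R * R, I p.1 -> I p.2 -> (p.1 <= p.2)%R ->
        extdist (gam p.1) (gam p.2) <= m `[p.1, p.2]%classic}.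
Proof.
move=> [F [C [[ndF bF] [N N0 gF]]]].
have [m mE] := exists_monotone_measure ndF bF; exists m.
have [M [mM M0 NM]] := negligibleU N0 (negligible_neq_rlim ndF).
exists (M `*` setT `|` setT `*` M); split.
- by apply: measurableU; exact: measurableX.
- apply/eqP; rewrite -measure_le0.
  apply: le_trans (measureU2 _ _ _) _; [exact: measurableX..|].
  have e1 : (mu \x mu) (M `*` setT) = 0 by rewrite product_measure1E// M0 mul0e.
  have e2 : (mu \x mu) (setT `*` M) = 0 by rewrite product_measure1E// M0 mule0.
  by rewrite [X in X + _]e1 [X in _ + X]e2 adde0.
move=> [s t] /= nst; apply: contrapT => /not_orP nM; apply: nst => Is It.
have [{}nMs {}nMt] : ~ M s /\ ~ M t.
  by move: nM => /= [nMs nMt]; split => [Ms|Mt]; [exact: nMs|exact: nMt].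
rewrite le_eqVlt => /predU1P[->|st]; first by rewrite (extdist_eq0 _ _).2.
apply: (@le_trans _ _ (F t - F s)%:E).
  by apply: gF => //; split => // ?; [apply: nMs|apply: nMt]; apply: NM; left.
apply: (@le_trans _ _ (m `]s, t]%classic)); last first.
  by rewrite le_measure ?inE//; apply: subset_itv; rewrite leBSide/=.
rewrite mE; last exact: ltW.
(* At [t] the inequality between [F] and its right limit goes the right way; at [s] equality is
   required, which is why jumps were discarded. *)
rewrite lee_fin lerB//; first exact: le_rlim.
have -> : rlim F s = F s; last by [].
by apply/eqP; apply: contrapT => /negP sF; apply/nMs/NM; right; rewrite /= eq_sym.
Qed.

(** By Fubini almost every section of the bad set is null, so between [s] and [t] there is [r] such
    that [(s, r)] and [(r, t)] are both good pairs. Each of the two distances is at most the mass of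
    the closed interval from [s] to [t], whence the factor 2. Discarding the atoms removes the mass
    of [s]. *)
Lemma product_strong_bv (m : {finite_measure set (measurableTypeR R) -> \bar R}) :
  {ae (mu \x mu), forall p : R * R, I p.1 -> I p.2 -> (p.1 <= p.2)%R ->
        extdist (gam p.1) (gam p.2) <= m `[p.1, p.2]%classic} ->
  strong_bv T gam.
Proof.
move=> [M [mM M0 badM]].
have [ndF bF] := bounded_monotone_distribution_function m.
set F := distribution_function m in ndF bF.
exists (fun x => (F x *+ 2)%R), (fine (m setT) *+ 2)%R; split.
  split=> [x y xy|x]; first by rewrite lerMn2r ndF.
  by rewrite mulrn_wge0 ?lerMn2r//; have /andP[] := bF x.
have xM0 : {ae mu, forall x, mu (xsection M x) = 0}.
  have := measurable_fun_xsection mu mM; set f := mu \o _ => mf.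
  have /(ae_eq_integral_abs mu measurableT mf).1 : \int[mu]_x `|f x| = 0.
    by under eq_integral do rewrite gee0_abs//.
  by apply: filterS => x /= /(_ Logic.I).
have yM0 : {ae mu, forall x, mu (ysection M x) = 0}.
  have := measurable_fun_ysection mu mM; set f := mu \o _ => mf.
  have /(ae_eq_integral_abs mu measurableT mf).1 : \int[mu]_x `|f x| = 0.
    under eq_integral do rewrite gee0_abs//.
    (* The product measure is defined by integrating over the first variable; the other order of
       integration comes from uniqueness of the product measure. *)
    rewrite -[RHS]M0 -/((mu \x^ mu) M); apply: esym.
    apply: product_measure_unique => // A B mA mB.
    exact: product_measure2E.
  by apply: filterS => x /= /(_ Logic.I).
exists (~` [set x | mu (xsection M x) = 0] `|` ~` [set x | mu (ysection M x) = 0]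
    `|` [set x | m [set x] != 0]).
  by apply: negligibleU; [exact: negligibleU|exact: negligible_atoms].
move=> s t [Is nNs] [It nNt] st.
have xs0 : mu.-negligible (xsection M s).
  apply/negligibleP; first exact: measurable_xsection.
  by apply: contrapT => ns; apply: nNs; left; left.
have yt0 : mu.-negligible (ysection M t).
  apply/negligibleP; first exact: measurable_ysection.
  by apply: contrapT => ns; apply: nNt; left; right.
have ms0 : m [set s] = 0.
  by apply/eqP; apply: contrapT => /negP ms; apply: nNs; right.
have [r /andP[sr rt] /not_orP[nsr nrt]] := nonnegligible_itv (negligibleU xs0 yt0) st.
have Ir : I r.
  move: Is It; rewrite /I/= !in_itv/= => /andP[s0 _] /andP[_ tT].
  by rewrite (lt_trans s0 sr) (lt_trans rt tT).
have bd u v : ~ M (u, v) -> I u -> I v -> (s <= u)%R -> (u < v)%R -> (v <= t)%R ->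
    extdist (gam u) (gam v) <= (F t - F s)%:E.
  move=> nM Iu Iv su uv vt.
  apply: (@le_trans _ _ (m `[u, v]%classic)).
    by apply: contrapT => H; apply/nM/badM => /= /(_ Iu Iv (ltW uv)).
  apply: (@le_trans _ _ (m ([set s] `|` `]s, t]%classic))).
    rewrite le_measure ?inE//; first exact: measurableU.
    move=> z /=; rewrite !in_itv/= => /andP[uz zv].
    have /predU1P[<-|sz] : (s == z) || (s < z)%R by rewrite -le_eqVlt (le_trans su).
      by left.
    by right; rewrite sz (le_trans zv).
  apply: le_trans (measureU2 _ _ _) _ => //.
  by rewrite [X in X + _]ms0 add0e [leLHS](distribution_functionB m (ltW st)).
apply: le_trans (extdist_triangle (gam r) _ _) _.
rewrite -mulrnBl mulr2n EFinD leeD// bd ?(ltW sr) ?(ltW rt)//.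
  by move=> Msr; apply: nsr; rewrite /xsection/= inE.
by move=> Msr; apply: nrt; rewrite /ysection/= inE.
Qed.

End product_characterization.

(** * A common null set for all test functions *)

Section truncated_distance.
Context {R : realType} {X : extMetricType R}.
Implicit Types (x y : X) (A : set X) (K : R).

Definition dist_to A x : \bar R := ereal_inf [set extdist x a | a in A].

Lemma dist_to_ge0 A x : 0 <= dist_to A x.
Proof. by apply: le_ereal_inf_tmp => _ [a _ <-]; exact: extdist_ge0. Qed.

Lemma dist_to_le A x y : dist_to A x <= extdist x y + dist_to A y.
Proof.
have [dxy|] := boolP (extdist x y \is a fin_num); last first.
  rewrite ge0_fin_numE ?extdist_ge0// -leNgt leye_eq => /eqP ->.
  by rewrite addye ?leey// gt_eqF// (lt_le_trans (ltNy0))// dist_to_ge0.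
rewrite -leeBlDl//; apply: le_ereal_inf_tmp => _ [a Aa <-].
rewrite leeBlDl//; apply: le_trans (extdist_triangle y _ _).
by apply: ereal_inf_lbound; exists a.
Qed.

(** Truncation turns a possibly infinite distance into a bounded real test function. For empty [A]
    the infimum is [+oo] and the function is the constant [K]. *)
Definition truncated_dist A K x : R := fine (mine K%:E (dist_to A x)).

Section truncated_dist_lemmas.
Variables (A : set X) (K : R).
Hypothesis K0 : (0 <= K)%R.

Lemma truncated_distE x : (truncated_dist A K x)%:E = mine K%:E (dist_to A x).
Proof.
rewrite fineK// ge0_fin_numE; last by rewrite le_min lee_fin K0 dist_to_ge0.
by rewrite gt_min ltry.
Qed.

Lemma truncated_dist_bound x : (0 <= truncated_dist A K x <= K)%R.
Proof.
by rewrite -!lee_fin truncated_distE le_min lee_fin K0 dist_to_ge0 ge_min lexx.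
Qed.

Lemma Lip1_truncated_dist : Lip1 (truncated_dist A K).
Proof.
have le x y : (truncated_dist A K x)%:E <= extdist x y + (truncated_dist A K y)%:E.
  rewrite !truncated_distE; case: (leP K%:E (dist_to A y)) => _.
    by rewrite ge_min leeDr ?extdist_ge0.
  by rewrite ge_min dist_to_le orbT.
move=> x y; have [dxy|] := boolP (extdist x y \is a fin_num); last first.
  by rewrite ge0_fin_numE ?extdist_ge0// -leNgt leye_eq => /eqP ->; rewrite leey.
rewrite -(fineK dxy) lee_fin ler_norml lerBDr lerBlDr.
have := le x y; have := le y x; rewrite extdist_sym -(fineK dxy) -!EFinD !lee_fin.
by move=> ? ?; apply/andP; split; lra.
Qed.

Lemma truncated_dist_eq0 x : A x -> truncated_dist A K x = 0%R.
Proof.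
move=> Ax; apply: EFin_inj; rewrite truncated_distE.
have -> : dist_to A x = 0.
  apply/eqP; rewrite eq_le dist_to_ge0 andbT.
  by apply: ereal_inf_lbound; exists x => //; exact/extdist_eq0.
by rewrite min_r.
Qed.

Lemma truncated_dist_ge x : (forall a, A a -> K%:E <= extdist x a) ->
  truncated_dist A K x = K.
Proof.
move=> KA; apply: EFin_inj; rewrite truncated_distE min_l//.
by apply: le_ereal_inf_tmp => _ [a Aa <-]; exact: KA.
Qed.

End truncated_dist_lemmas.

Lemma dist_to1 c x : dist_to [set c] x = extdist x c.
Proof. by rewrite /dist_to image_set1 ereal_inf1. Qed.

End truncated_distance.

(** * Almost separable range *)

Section weak_increments.
Context {R : realType} {X : extMetricType R}.
Variables (T : R) (gam : R -> X).
Let I : set R := `]0%R, T[%classic.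
Local Notation mu := (@lebesgue_measure R).

Definition real_dist (x y : R) : \bar R := `|x - y|%:E.

Definition weak_bv := exists F C, bounded_monotone F C /\
  forall phi : X -> R, Lip1 phi -> (exists M, forall x, 0 <= phi x <= M)%R ->
  ae_increment_le real_dist (phi \o gam) I F.

Lemma ae_increment_sym (u F : R -> R) : ae_increment_le real_dist u I F ->
  {homo F : x y / (x <= y)%R} ->
  exists2 N, mu.-negligible N & forall s t, (I `\` N) s -> (I `\` N) t ->
    (`|u s - u t| <= `|F s - F t|)%R.
Proof.
move=> [N N0 uF] ndF; exists N => // s t As At.
have [st|ts|->] := ltgtP s t; last by rewrite !subrr.
  have := uF _ _ As At st; rewrite lee_fin => /le_trans; apply.
  by rewrite distrC ler_norm.
have := uF _ _ At As ts; rewrite lee_fin distrC => /le_trans; apply.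
by rewrite ler_norm.
Qed.

Section separability.
Variables (F : R -> R) (C : R) (bF : bounded_monotone F C).
Hypothesis gF : forall phi : X -> R, Lip1 phi ->
  (exists M, forall x, 0 <= phi x <= M)%R ->
  ae_increment_le real_dist (phi \o gam) I F.

Section fixed_radius.
Variables (W : rel R) (sigma : R -> R) (delta : R).
Hypothesis W_anti : forall s t, W s t -> W t s -> s = t.
Hypothesis W_total : forall s t, W s t || W t s.
Hypothesis sigma_center : forall t, extdist (gam t) (gam (sigma t)) < delta%:E.
Hypothesis sigma_min : forall t s, extdist (gam t) (gam s) < delta%:E -> W (sigma t) s.

(** With [e = 1 / (n + 1)], the slack [e] in the distance to the centre yields the separation of
    points with different centres, and the bounds on [F] make its oscillation on the piece less than
    [e / 2], too small for a jump of size [e]. *)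
Let piece n k := [set t | [/\ I t,
  extdist (gam t) (gam (sigma t)) <= (delta - n.+1%:R^-1)%:E,
  (k%:R * (n.+1%:R^-1 / 2) <= F t)%R & (F t < k.+1%:R * (n.+1%:R^-1 / 2))%R]].

(* Stone's trick: in a given piece, points with different first centres are
   uniformly far apart. *)
Let piece_separated n k s t : piece n k s -> piece n k t -> sigma s != sigma t ->
  (n.+1%:R^-1)%:E <= extdist (gam s) (gam t).
Proof.
wlog st : s t / W (sigma s) (sigma t) => [hw ps pt ne|].
  have /orP[st|ts] := W_total (sigma s) (sigma t); first exact: hw.
  by rewrite extdist_sym; apply: hw => //; rewrite eq_sym.
move=> [_ ds _ _] _ /eqP ne; rewrite leNgt; apply/negP => dst.
(* If the two points were closer, [sigma s] would be a possible centre for [t], and minimality of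
   [sigma t] would force the two centres to coincide. *)
apply: ne; apply: W_anti => //; apply: sigma_min.
apply: le_lt_trans (extdist_triangle (gam s) _ _) _.
have -> : delta%:E = (n.+1%:R^-1)%:E + (delta - n.+1%:R^-1)%:E.
  by rewrite -EFinD addrC subrK.
rewrite extdist_sym lte_leD// ge0_fin_numE ?extdist_ge0//.
exact: le_lt_trans ds (ltry _).
Qed.

(* A two-valued measure on a set of reals that is not zero is carried by a point. *)
Let piece_dichotomy n k (S : set R) :
  mu.-negligible [set t | piece n k t /\ S (sigma t)] \/
  mu.-negligible [set t | piece n k t /\ ~ S (sigma t)].
Proof.
set e : R := n.+1%:R^-1%R; have e0 : (0 < e)%R by rewrite invr_gt0.
set B := [set t | _ /\ S _]; set B' := [set t | _ /\ ~ S _].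
(* By separation [phi] is [0] along the first set and [e] along the second, while [F] varies by less
   than [e / 2] on the piece: off the null set [N], the two sets cannot both have points. *)
pose phi := truncated_dist (gam @` B) e.
have Lphi : Lip1 phi by apply: Lip1_truncated_dist; exact: ltW.
have bphi : (exists M, forall x, 0 <= phi x <= M)%R.
  by exists e => x; apply: truncated_dist_bound; exact: ltW.
have [ndF _] := bF.
have [N N0 uF] := ae_increment_sym (gF Lphi bphi) ndF.
have [Bsub|] := pselect (B `<=` N); first by left; exact: negligibleS N0.
move=> /existsNP[t0 /not_implyP[[pt0 St0] Nt0]]; right.
apply: negligibleS N0 => t [pt St]; apply: contrapT => Nt.
have [[It0 _ Ft0 Ft0'] [It _ Ft Ft']] := (pt0, pt).
have := uF t t0 (conj It Nt) (conj It0 Nt0).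
have -> : (phi \o gam) t0 = 0%R.
  by apply: truncated_dist_eq0; [exact: ltW|exists t0].
have -> : (phi \o gam) t = e.
  apply: truncated_dist_ge; first exact: ltW.
  move=> _ [s [ps Ss] <-]; apply: (piece_separated pt ps).
  by apply/eqP => st; apply: St; rewrite st.
have kS : (k.+1%:R * (e / 2) = k%:R * (e / 2) + e / 2)%R.
  by rewrite -natr1 mulrDl mul1r.
rewrite subr0 ger0_norm ?(ltW e0)//; apply/negP; rewrite -ltNge ltr_norml.
move: Ft Ft0 Ft' Ft0'; rewrite -/e kS; set c := (k%:R * (e / 2))%R => *.
by apply/andP; split; lra.
Qed.

(** The dichotomy is applied to the half-lines with rational endpoint. Two distinct values of
    [sigma] would be separated by a rational [q], and one of the two sides of [q] has been
    discarded. *)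
Let piece_constant n k : exists2 N, mu.-negligible N &
  exists s, forall t, piece n k t -> ~ N t -> sigma t = s.
Proof.
pose B (q : rat) := [set t | piece n k t /\ (sigma t < ratr q)%R].
pose B' (q : rat) := [set t | piece n k t /\ ~ (sigma t < ratr q)%R].
have /choice[N HN] : forall m : nat, exists N, mu.-negligible N /\
    (let q := odflt 0%R (unpickle m) in N = B q \/ N = B' q).
  move=> m; have := piece_dichotomy n k [set x | (x < ratr (odflt 0 (unpickle m)))%R].
  by case=> ?; eexists; split; eauto.
exists (\bigcup_m N m); first by apply: negligible_bigcup => m; have [] := HN m.
have sep s t : piece n k s -> piece n k t -> ~ (\bigcup_m N m) s ->
    ~ (\bigcup_m N m) t -> ~ (sigma s < sigma t)%R.
  move=> ps pt Ns Nt /rat_in_itvoo[q]; rewrite in_itv/= => /andP[sq qt].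
  have [_] := HN (pickle q); rewrite pickleK /= => -[] Nq.
    by apply: Ns; exists (pickle q) => //; rewrite Nq.
  apply: Nt; exists (pickle q) => //; rewrite Nq; split => //.
  by apply/negP; rewrite -leNgt ltW.
have [[t0 [pt0 Nt0]]|none] := pselect (exists t, piece n k t /\ ~ (\bigcup_m N m) t).
  exists (sigma t0) => t pt Nt; apply/eqP; rewrite eq_le !leNgt.
  by apply/andP; split; apply/negP; exact: sep.
by exists 0%R => t pt Nt; exfalso; apply: none; exists t.
Qed.

Let piece_cover t : I t -> exists n k, piece n k t.
Proof.
move=> It; have := sigma_center t; have := extdist_ge0 (gam t) (gam (sigma t)).
case E : extdist => [r| |]//; rewrite lee_fin lte_fin => r0 rd.
have [n nr] : exists n, (n.+1%:R^-1 < delta - r)%R.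
  have /ltr_add_invr[n] : (0 < delta - r)%R by rewrite subr_gt0.
  by rewrite add0r; exists n.
have e0 : (0 < (n.+1%:R^-1 / 2) :> R)%R by rewrite divr_gt0// invr_gt0.
exists n, (Num.truncn (F t / (n.+1%:R^-1 / 2))); split => //.
- by rewrite E lee_fin lerBrDr -lerBrDl ltW.
- by rewrite -ler_pdivlMr// truncn_le divr_ge0 ?(ltW e0)//; have [_ /(_ t)/andP[]] := bF.
- by rewrite -ltr_pdivrMr// truncnS_gt.
Qed.

Lemma ae_separable_radius : exists2 N, mu.-negligible N &
  exists c : nat -> R, forall t, (I `\` N) t ->
    exists j, extdist (gam t) (gam (c j)) < delta%:E.
Proof.
have /choice[N /choice[c Hc]] : forall m : nat, exists N s, mu.-negligible N /\
    (let p := odflt (0, 0)%N (unpickle m) in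
    forall t, piece p.1 p.2 t -> ~ N t -> sigma t = s).
  move=> m; have [N N0 [s Hs]] := piece_constant (odflt (0, 0)%N (unpickle m)).1
    (odflt (0, 0)%N (unpickle m)).2.
  by exists N, s.
exists (\bigcup_m N m); first by apply: negligible_bigcup => m; have [] := Hc m.
exists c => t [It Nt]; have [n [k pt]] := piece_cover It.
have [_] := Hc (pickle (n, k)); rewrite pickleK/= => /(_ t pt) ct.
exists (pickle (n, k)); rewrite -ct; first exact: sigma_center.
by move=> ?; apply: Nt; exists (pickle (n, k)).
Qed.

End fixed_radius.

Lemma ae_separable (delta : R) : (0 < delta)%R ->
  exists2 N, mu.-negligible N &
  exists c : nat -> R, forall t, (I `\` N) t ->
    exists j, extdist (gam t) (gam (c j)) < delta%:E.
Proof.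
move=> d0; have [W Wwo] := well_ordering_principle R.
have W_anti s t : W s t -> W t s -> s = t.
  have anti := wo_chain_antisymmetric (C := predT) (withinW Wwo).
  by move=> st ts; apply: anti => //; apply/andP.
have W_total s t : W s t || W t s.
  by have total := wo_chainW (C := predT) (withinW Wwo); exact: total.
have /choice[sigma Hsigma] : forall t, exists s,
    extdist (gam t) (gam s) < delta%:E /\
    forall r, extdist (gam t) (gam r) < delta%:E -> W s r.
  move=> t; pose A : {pred R} := fun s => extdist (gam t) (gam s) < delta%:E.
  have [|s [[As sA] _]] := Wwo A.
    by exists t; rewrite /A unfold_in (extdist_eq0 _ _).2// lte_fin.
  by exists s; split => // r Ar; exact: sA.
apply: (ae_separable_radius (sigma := sigma) W_anti W_total) => [t|t s].
  by have [] := Hsigma t.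
by have [_] := Hsigma t; apply.
Qed.

(** If [c] is a centre within [1 / (m + 1)] of [gam s], the truncated distance to [c] is small at
    [s], hence at most [1 / (m + 1) + F t - F s] at [t]; the triangle inequality through [c]
    concludes as [m] grows. Countably many centres and truncation levels occur. *)
Lemma weak_to_strong_increments : ae_increment_le extdist gam I F.
Proof.
have [ndF _] := bF.
have /choice[N /choice[c Hc]] : forall m : nat, exists N (c : nat -> R),
    mu.-negligible N /\ forall t, (I `\` N) t ->
    exists j, extdist (gam t) (gam (c j)) < (m.+1%:R^-1)%:E.
  move=> m; have m0 : (0 < m.+1%:R^-1 :> R)%R by rewrite invr_gt0.
  by have [N N0 [c Hc]] := ae_separable m0; exists N, c.
pose phi m j K := truncated_dist [set gam (c m j)] K%:R : X -> R.
have /choice[M HM] : forall p : nat, exists M, mu.-negligible M /\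
    increment_le real_dist
      (let: (m, j, K) := odflt (0, 0, 0)%N (unpickle p) in phi m j K \o gam)
      (I `\` M) F.
  move=> p; case: (odflt _ _) => -[m j] K.
  have [||M M0 HM] := @gF (phi m j K); [exact: Lip1_truncated_dist| |by exists M].
  by exists K%:R => x; exact: truncated_dist_bound.
exists (\bigcup_m N m `|` \bigcup_p M p).
  apply: negligibleU; apply: negligible_bigcup => m; first by have [] := Hc m.
  by have [] := HM m.
move=> s t [Is /not_orP[Ns Ms]] [It /not_orP[Nt Mt]] st.
apply/lee_addgt0Pr => e e0.
have [m me] : exists m, (m.+1%:R^-1 < e / 2)%R.
  have /ltr_add_invr[m] : (0 < e / 2)%R by rewrite divr_gt0.
  by rewrite add0r; exists m.
have [_ /(_ s)[|j dsj]] := Hc m.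
  by split => // ?; apply: Ns; exists m.
(* The level exceeds the bound expected at [t], so the truncation is inactive there and the true
   distance is recovered. *)
pose K := (Num.truncn (m.+1%:R^-1 + (F t - F s) : R)%R).+1.
have [_ /(_ s t)] := HM (pickle (m, j, K)).
rewrite pickleK/= => /(_ _ _ st) h.
have {h} : real_dist (phi m j K (gam s)) (phi m j K (gam t)) <= (F t - F s)%:E.
  by apply: h; split => // ?; [apply: Ms|apply: Mt]; exists (pickle (m, j, K)).
rewrite lee_fin; set a := phi m j K (gam s); set b := phi m j K (gam t).
set i : R := (m.+1%:R^-1)%R in me dsj K a b *; set D := (F t - F s)%R in K a b *.
move=> /ler_normlP[abD _].
have aE : a%:E = mine K%:R%:E (extdist (gam s) (gam (c m j))).
  by rewrite -dist_to1 truncated_distE.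
have bE : b%:E = mine K%:R%:E (extdist (gam t) (gam (c m j))).
  by rewrite -dist_to1 truncated_distE.
have ai : (a < i)%R by rewrite -lte_fin aE gt_min dsj orbT.
have bK : (b < K%:R)%R.
  by apply: (@le_lt_trans _ _ (i + D)%R); [lra|exact: truncnS_gt].
have {}bE : extdist (gam t) (gam (c m j)) = b%:E.
  by move: bK; rewrite -lte_fin bE gt_min ltxx /= => /ltW/min_r.
apply: le_trans (extdist_triangle (gam (c m j)) _ _) _.
rewrite (extdist_sym _ (gam t)) bE; apply: le_trans (leeD2r _ (ltW dsj)) _.
by rewrite -!EFinD lee_fin; lra.
Qed.

End separability.

Lemma strong_bv_of_weak_bv : weak_bv -> strong_bv T gam.
Proof.
move=> [F [C [bF gF]]]; exists F, C; split => //.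
exact: weak_to_strong_increments bF gF.
Qed.

End weak_increments.

(** * From difference quotients to bounds on increments *)

Section lebesgue_points.
Context {R : realType}.
Local Notation mu := (@lebesgue_measure R).

(** A one-sided Lebesgue point, since the averages used below all extend to the right. *)
Definition right_lebesgue_pt (u : R -> R) (t : R) := forall e : R, (0 < e)%R ->
  exists2 d, (0 < d)%R & forall h, (0 < h < d)%R ->
  \int[mu]_(y in `[t, (t + h)%R[) `|u y - u t|%:E <= (e * h)%:E.

(** Lebesgue differentiation concerns balls: the interval from [t] to [t + h] lies in the ball of
    radius [2h], of measure [4h], which explains [e / 4]. *)
Lemma ae_right_lebesgue_pt (u : R -> R) (a b : R) :
  mu.-integrable `]a, b[ (EFin \o u) ->
  {ae mu, forall t, t \in `]a, b[ -> right_lebesgue_pt u t}.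
Proof.
move=> iu; set I : set R := `]a, b[%classic.
have mI : measurable I by exact: measurable_itv.
have := lebesgue_differentiation (integrable_locally mI iu).
apply: filterS; first exact: (ae_filter_ringOfSetsType mu).
move=> t ut tI e e0.
have e4 : (0 < e / 4)%R by rewrite divr_gt0.
have tb : (t < b)%R by move: tI; rewrite in_itv/= => /andP[].
have oe : nbhs (0 : \bar R) [set x | x < (e / 4)%:E].
  by apply: open_nbhs_nbhs; split; [exact: open_ereal_lt_ereal|rewrite /= lte_fin].
have [d /= d0 Hd] := ut _ oe.
exists (Num.min (d / 2) (b - t))%R; first by rewrite lt_min divr_gt0// subr_gt0.
move=> h /andP[h0]; rewrite lt_min => /andP[hd hb].
have thI y : `[t, (t + h)%R[%classic y -> I y.
  move: tI; rewrite /I/= !in_itv/= => /andP[ta _] /andP[ty yt].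
  by rewrite (lt_le_trans ta)//= (lt_trans yt)// -ltrBrDl.
have th : `[t, (t + h)%R[%classic `<=` ball t (h *+ 2)%R.
  move=> y /=; rewrite in_itv/= => /andP[ty yt]; rewrite /ball/= ler0_norm ?subr_le0//.
  by rewrite opprB mulr2n; lra.
have := Hd (h *+ 2)%R; rewrite /ball_/= sub0r normrN gtr0_norm ?mulrn_wgt0//.
move=> /(_ _ _)/ltW; rewrite /davg /iavg.
rewrite (lebesgue_measure_ball t) ?mulrn_wge0 ?(ltW h0)//.
set J := \int[mu]_(y in ball _ _) _ => HJ.
apply: (@le_trans _ _ J).
  have -> : \int[mu]_(y in `[t, (t + h)%R[) `|u y - u t|%:E =
      \int[mu]_(y in `[t, (t + h)%R[) `|((center ((u \_ I) t) \o (u \_ I)) y)%:E|.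
    by apply: eq_integral => y /[1!inE] /thI yI; rewrite /= !patchE !mem_set.
  apply: ge0_subset_integral => //; first exact: measurable_ball.
  apply: measurableT_comp => //; apply/measurable_EFinP.
  apply: (measurable_funS measurableT) => //; apply: measurable_funD => //.
  apply/(measurable_restrictT _ _).1 => //.
  by move/integrableP : iu => [/measurable_EFinP].
have h4 : (0 < h *+ 2 *+ 2)%R by rewrite !mulrn_wgt0.
have {}HJ : J <= (h *+ 2 *+ 2)%:E * (e / 4)%:E.
  have := HJ; rewrite inver gt_eqF// lee_pdivrMl//; apply=> //.
  by rewrite mulr2n (splitr d) ltrD.
apply: le_trans HJ _; rewrite -EFinM lee_fin.
have -> : (h *+ 2 *+ 2 = h * 4)%R by rewrite -mulrnA mulr_natr.
lra.
Qed.

End lebesgue_points.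

Section lip1_measurable.
Context {R : realType} {X : extMetricType R}.

Lemma measurable_Lip1_comp (I : set R) (gam : R -> X) (phi : X -> R) :
  Borel_map I gam -> Lip1 phi -> measurable_fun I (phi \o gam).
Proof.
move=> mgam Lphi.
apply: (measurability _ (RGenOInfty.measurableE R)) => _ [_ [c ->] <-].
rewrite comp_preimage; apply: mgam; apply: sub_sigma_algebra.
rewrite openE => x /=; rewrite in_itv/= andbT => cx.
apply/nbhs_ballP; exists (phi x - c)%R => /=; first by rewrite subr_gt0.
move=> y; rewrite ballE_extdist/= in_itv/= andbT => /(le_lt_trans (Lphi x y)).
by rewrite lte_fin => /ltr_normlW; rewrite ltrD2l ltrN2.
Qed.

End lip1_measurable.

Section difference_quotient.
Context {R : realType}.
Variables (T : R) (u : R -> R) (M : R).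
Let I : set R := `]0%R, T[%classic.
Local Notation mu := (@lebesgue_measure R).
Hypotheses (u_meas : measurable_fun I u) (bu : forall x, (0 <= u x <= M)%R).

Let u_ge0 x : (0 <= u x)%R. Proof. by have /andP[] := bu x. Qed.

Let mitv (a b : R) : (0 < a)%R -> (b <= T)%R -> `[a, b[%classic `<=` I.
Proof.
move=> a0 bT x /=; rewrite /I/= !in_itv/= => /andP[ax xb].
by rewrite (lt_le_trans a0)// (lt_le_trans xb).
Qed.

Let u_meas_itv (a b : R) : (0 < a)%R -> (b <= T)%R ->
  measurable_fun `[a, b[ (EFin \o u).
Proof.
move=> a0 bT; apply/measurable_EFinP; apply: measurable_funS u_meas.
  exact: measurable_itv.
exact: mitv.
Qed.

Let fin_itv (a b : R) (f : R -> \bar R) : (forall x, 0 <= f x <= M%:E) ->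
  measurable_fun `[a, b[ f -> \int[mu]_(y in `[a, b[) f y \is a fin_num.
Proof.
move=> bf mf.
have f0 x : 0 <= f x by have /andP[] := bf x.
rewrite ge0_fin_numE; last exact: integral_ge0.
apply: (@le_lt_trans _ _ (\int[mu]_(y in `[a, b[) (cst M%:E) y)).
  by apply: ge0_le_integral => // x _; have /andP[] := bf x.
rewrite integral_cst//= lebesgue_measure_itv/=; case: ifPn => _.
  by rewrite -EFinD -EFinM ltry.
by rewrite mule0.
Qed.

Let preim (a b h : R) :
  (fun x => x + h)%R @^-1` `[(a + h)%R, (b + h)%R[ = `[a, b[%classic.
Proof. by apply/seteqP; split => x /=; rewrite !in_itv/= lerD2r ltrD2r. Qed.

Let measurable_shift (s t h : R) : (0 < s)%R -> (0 < h)%R -> (t + h <= T)%R ->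
  measurable_fun `[s, t[ (fun r => u (r + h)).
Proof.
move=> s0 h0 tT.
have mh : measurable_fun setT (fun x : R => x + h)%R by exact: measurable_funD.
rewrite -[X in measurable_fun X](preim s t h) => _ B mB.
rewrite preim; have := u_meas_itv (a := s + h) (b := t + h) _ tT.
move=> /(_ (addr_gt0 s0 h0))/measurable_EFinP/(_ (measurable_itv _) _ mB) mBh.
have := mh measurableT _ mBh; rewrite setTI.
by rewrite preimage_setI preim.
Qed.

Lemma measurable_difference (s t h : R) :
  (0 < s)%R -> (0 < h)%R -> (t + h <= T)%R ->
  measurable_fun `[s, t[ (fun r => `|u (r + h) - u r|%:E).
Proof.
move=> s0 h0 tT; apply/measurable_EFinP; apply: measurableT_comp => //.
apply: measurable_funB; first exact: measurable_shift.
apply/measurable_EFinP; apply: u_meas_itv => //; apply: le_trans tT.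
by rewrite lerDl ltW.
Qed.

(** The integral of [u] from [s] to [t + h] can be cut at [s + h] or at [t]. Comparing the two
    expressions, [A t - A s] is the integral of [u (r + h) - u r] from [s] to [t]. *)
Lemma average_difference_le (s t h : R) : (0 < s)%R -> (s < t)%R -> (0 < h)%R ->
  (t + h <= T)%R ->
  let A x := \int[mu]_(y in `[x, (x + h)%R[) (u y)%:E in
  let D := \int[mu]_(r in `[s, t[) `|u (r + h) - u r|%:E in
  A t <= D + A s /\ A s <= D + A t.
Proof.
move=> s0 st h0 tT A D.
have bE x : 0 <= (u x)%:E <= M%:E by rewrite !lee_fin.
have t0 : (0 < t)%R by exact: lt_trans st.
have sth : (s + h <= t + h)%R by rewrite lerD2r ltW.
have shT : (s + h <= T)%R by exact: le_trans tT.
have tT' : (t <= T)%R by apply: le_trans tT; rewrite lerDl ltW.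
have mst : measurable_fun `[s, t[ u by apply/measurable_EFinP; exact: u_meas_itv.
have msth := measurable_shift s0 h0 tT.
pose a := \int[mu]_(r in `[s, t[) (u r)%:E.
pose b := \int[mu]_(r in `[s, t[) (u (r + h))%:E.
have union (x y z : R) : (0 < x)%R -> (x <= y)%R -> (y <= z)%R -> (z <= T)%R ->
    \int[mu]_(r in `[x, z[) (u r)%:E =
    \int[mu]_(r in `[x, y[) (u r)%:E + \int[mu]_(r in `[y, z[) (u r)%:E.
  move=> x0 xy yz zT; rewrite -ge0_integral_setU//.
  - congr (integral _ _ _); apply/seteqP; split => r /=; rewrite !in_itv/=.
      by move=> /andP[xr rz]; case: (ltP r y) => ry; [left; rewrite xr|right].
    move=> [/andP[-> ry]|/andP[yr ->]]; first by rewrite (lt_le_trans ry).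
    by rewrite (le_trans xy).
  - rewrite (_ : _ `|` _ = `[x, z[%classic); first exact: u_meas_itv.
    apply/seteqP; split => r /=; rewrite !in_itv/=.
      move=> [/andP[-> ry]|/andP[yr ->]]; first by rewrite (lt_le_trans ry).
      by rewrite (le_trans xy).
    by move=> /andP[xr rz]; case: (ltP r y) => ry; [left; rewrite xr|right].
  - by move=> r _; rewrite lee_fin.
  - apply/disj_setPS => r /= []; rewrite !in_itv/= => /andP[_ ry] /andP[yr _].
    by rewrite ltNge yr in ry.
have e1 : b + A s = a + A t.
  rewrite /A -union ?(ltW st)//; last by rewrite lerDl ltW.
  rewrite (union s (s + h)%R)//; last by rewrite lerDl ltW.
  rewrite addeC; congr (_ + _); rewrite /b -(preim s t h).
  rewrite (@ge0_integral_translation _ _ (EFin \o u))//.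
    by apply: u_meas_itv => //; exact: addr_gt0.
  by move=> r _; rewrite lee_fin.
have mD := measurable_difference s0 h0 tT.
have e2 : b <= a + D.
  apply: (@le_trans _ _
      (\int[mu]_(r in `[s, t[) ((u r)%:E + `|u (r + h) - u r|%:E))); last first.
    rewrite ge0_integralD//.
    - by move=> r _; rewrite lee_fin.
    - exact/measurable_EFinP.
  apply: ge0_le_integral => //.
  - by move=> r _; rewrite lee_fin.
  - exact/measurable_EFinP.
  - by apply: emeasurable_funD => //; exact/measurable_EFinP.
  - move=> r _; rewrite -EFinD lee_fin -lerBlDl; exact: ler_norm.
have e3 : a <= b + D.
  apply: (@le_trans _ _
      (\int[mu]_(r in `[s, t[) ((u (r + h))%:E + `|u (r + h) - u r|%:E))); last first.
    rewrite ge0_integralD//.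
    - by move=> r _; rewrite lee_fin.
    - exact/measurable_EFinP.
  apply: ge0_le_integral => //.
  - by move=> r _; rewrite lee_fin.
  - exact/measurable_EFinP.
  - by apply: emeasurable_funD => //; exact/measurable_EFinP.
  - move=> r _; rewrite -EFinD lee_fin -lerBlDl distrC; exact: ler_norm.
have afin : a \is a fin_num by apply: fin_itv => //; exact/measurable_EFinP.
have bfin : b \is a fin_num.
  apply: (@fin_itv s t (fun r => (u (r + h))%:E)) => //; exact/measurable_EFinP.
have Asfin : A s \is a fin_num by apply: fin_itv => //; exact: u_meas_itv.
have Atfin : A t \is a fin_num by apply: fin_itv => //; exact: u_meas_itv.
have D0 : 0 <= D by apply: integral_ge0 => r _; rewrite lee_fin.
move: e1 e2 e3 D0; rewrite -(fineK afin) -(fineK bfin) -(fineK Asfin) -(fineK Atfin).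
case: D => [D||] //; last by move=> _ _ _ _; rewrite !addye// !leey.
rewrite -!EFinD !lee_fin => -[] e1 e2 e3 _; split; lra.
Qed.

Lemma average_bound (t h e : R) : (0 < t)%R -> (0 < h)%R -> (t + h <= T)%R ->
  \int[mu]_(y in `[t, (t + h)%R[) `|u y - u t|%:E <= (e * h)%:E ->
  let A := \int[mu]_(y in `[t, (t + h)%R[) (u y)%:E in
  A <= ((u t + e) * h)%:E /\ (u t * h)%:E <= A + (e * h)%:E.
Proof.
move=> t0 h0 tT He A.
have cstE : \int[mu]_(y in `[t, (t + h)%R[) (cst (u t)%:E) y = (u t * h)%:E.
  rewrite integral_cst//= lebesgue_measure_itv/= lte_fin ltrDl h0.
  by rewrite -EFinB addrAC subrr add0r -EFinM.
have m1 : measurable_fun `[t, (t + h)%R[ (fun y => `|u y - u t|%:E).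
  apply/measurable_EFinP; apply: measurableT_comp => //.
  by apply: measurable_funB => //; apply/measurable_EFinP; exact: u_meas_itv.
have m2 := u_meas_itv t0 tT.
split.
  rewrite mulrDl EFinD -cstE; apply: le_trans (leeD2l _ He).
  apply: (@le_trans _ _ (\int[mu]_(y in `[t, (t + h)%R[) (cst (u t)%:E y + `|u y - u t|%:E))).
    apply: ge0_le_integral => //.
    - by move=> r _; rewrite lee_fin.
    - exact: emeasurable_funD.
    - by move=> r _ /=; rewrite -EFinD lee_fin -lerBlDl; exact: ler_norm.
  by rewrite ge0_integralD// => y _; rewrite lee_fin.
rewrite -cstE; apply: le_trans (leeD2l _ He).
apply: (@le_trans _ _ (\int[mu]_(y in `[t, (t + h)%R[) ((u y)%:E + `|u y - u t|%:E))).
  apply: ge0_le_integral => //.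
  - by move=> r _; rewrite lee_fin.
  - exact: emeasurable_funD.
  - by move=> r _ /=; rewrite -EFinD lee_fin -lerBlDl distrC; exact: ler_norm.
by rewrite ge0_integralD// => y _; rewrite lee_fin.
Qed.

(** At right Lebesgue points the averages starting at [s] and [t] are [u s * h] and [u t * h], each
    up to [e / 2 * h]; their difference is controlled by the preceding cut of the integral. *)
Lemma difference_quotient_ge (s t e : R) : (0 < s)%R -> (s < t)%R -> (t < T)%R ->
  right_lebesgue_pt u s -> right_lebesgue_pt u t -> (0 < e)%R ->
  exists2 d, (0 < d)%R & forall h, (0 < h < d)%R -> (t + h < T)%R /\
    ((`|u t - u s| - e) * h)%:E <= \int[mu]_(r in `[s, t[) `|u (r + h) - u r|%:E.
Proof.
move=> s0 st tT us ut e0; have e2 : (0 < e / 2)%R by rewrite divr_gt0.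
have [ds ds0 Hs] := us _ e2; have [dt dt0 Ht] := ut _ e2.
have tT0 : (0 < T - t)%R by rewrite subr_gt0.
exists (Num.min ds (Num.min dt (T - t)))%R; first by rewrite !lt_min ds0 dt0.
move=> h /andP[h0]; rewrite !lt_min => /and3P[hs ht hT].
have tht : (t + h < T)%R by rewrite -ltrBrDl.
split => //.
have hs' : (0 < h < ds)%R by rewrite h0.
have ht' : (0 < h < dt)%R by rewrite h0.
have shT : (s + h <= T)%R by apply: ltW; apply: lt_trans tht; rewrite ltrD2r.
have t0 := lt_trans s0 st.
have [As1 As2] := average_bound s0 h0 shT (Hs _ hs').
have [At1 At2] := average_bound t0 h0 (ltW tht) (Ht _ ht').
have [D1 D2] := average_difference_le s0 st h0 (ltW tht).
have D0 : 0 <= \int[mu]_(r in `[s, t[) `|u (r + h) - u r|%:E.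
  by apply: integral_ge0 => r _; rewrite lee_fin.
have A0 x : 0 <= \int[mu]_(y in `[x, (x + h)%R[) (u y)%:E.
  by apply: integral_ge0 => r _; rewrite lee_fin.
have Asfin : \int[mu]_(y in `[s, (s + h)%R[) (u y)%:E \is a fin_num.
  by rewrite ge0_fin_numE ?A0// (le_lt_trans As1)// ltry.
have Atfin : \int[mu]_(y in `[t, (t + h)%R[) (u y)%:E \is a fin_num.
  by rewrite ge0_fin_numE ?A0// (le_lt_trans At1)// ltry.
move: As1 As2 At1 At2 D1 D2 D0; rewrite -(fineK Asfin) -(fineK Atfin).
case: (\int[mu]_(r in `[s, t[) _) => [D| |]; [|by move=> *; rewrite leey|by []].
rewrite -!EFinD !lee_fin => As1 As2 At1 At2 D1 D2 _.
by case: (ger0P (u t - u s)) => _; lra.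
Qed.

End difference_quotient.

Section from_difference_quotients.
Context {R : realType} {X : extMetricType R}.
Variables (T : R) (gam : R -> X) (C : R).
Let I : set R := `]0%R, T[%classic.
Local Notation mu := (@lebesgue_measure R).
Hypothesis T_gt0 : (0 < T)%R.
Hypothesis mgam : Borel_map I gam.
Hypothesis HC : forall h, I h ->
  \int[mu]_(t in `]0%R, (T - h)%R[%classic)
    (extdist (gam (t + h)%R) (gam t) * (h^-1)%:E) <= C%:E.

Let admissible (phi : X -> R) := Lip1 phi /\ exists M, forall x, (0 <= phi x <= M)%R.

Let good (phi : X -> R) t := I t /\ right_lebesgue_pt (phi \o gam) t.

(* [gain t c] if [c] is a sum of increments [|phi_i (gam t_i) - phi_i (gam s_i)|]
   along disjoint intervals [[s_i, t_i]] on the left of [t], where the test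
   function [phi_i] may change from one interval to the next. *)
Inductive gain : R -> R -> Prop :=
| gain0 t : gain t 0
| gain_mono s t c : (s <= t)%R -> gain s c -> gain t c
| gain_step s t c phi : gain s c -> (s < t)%R -> admissible phi ->
    good phi s -> good phi t ->
    gain t (c + `|phi (gam t) - phi (gam s)|)%R.

(** The witness [g] glues the increments over step [h] of the successive test functions, each on its
    own interval. It is a measurable minorant of the distance. Its vanishing from [t] on keeps the
    supports disjoint when a new interval is added. *)
Let gain_integral t c : gain t c -> forall e : R, (0 < e)%R ->
  exists2 d : R, (0 < d)%R & forall h, (0 < h < d)%R ->
  exists g : R -> \bar R, [/\ measurable_fun `]0%R, (T - h)%R[ g,
    forall r, 0 <= g r, forall r, (t <= r)%R -> g r = 0,
    forall r, r \in `]0%R, (T - h)%R[ -> g r <= extdist (gam (r + h)%R) (gam r) &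
    ((c - e) * h)%:E <= \int[mu]_(r in `]0%R, (T - h)%R[) g r].
Proof.
elim=> {t c} [t|s t c st _ IH|s t c phi _ IH st [Lphi [M bphi]] [Is gs] [It gt]] e e0.
- exists 1%R => // h /andP[h0 _]; exists (cst 0); split => //.
    by move=> r _; exact: extdist_ge0.
  by rewrite integral0 lee_fin sub0r mulNr oppr_le0 mulr_ge0// ltW.
- have [d d0 Hd] := IH _ e0; exists d => // h /Hd[g [mg g0 gt gd gi]].
  by exists g; split => // r tr; apply: gt; exact: le_trans tr.
have e2 : (0 < e / 2)%R by rewrite divr_gt0.
have [d d0 Hd] := IH _ e2.
have [s0 sT] : (0 < s)%R /\ (s < T)%R by move: Is; rewrite /I/= in_itv/= => /andP[].
have [t0 tT] : (0 < t)%R /\ (t < T)%R by move: It; rewrite /I/= in_itv/= => /andP[].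
have u_meas : measurable_fun I (phi \o gam) by exact: measurable_Lip1_comp.
have bu x : (0 <= (phi \o gam) x <= M)%R by exact: bphi.
have [d' d'0 Hd'] := difference_quotient_ge u_meas bu s0 st tT gs gt e2.
exists (Num.min d d'); first by rewrite lt_min d0.
move=> h /andP[h0]; rewrite lt_min => /andP[hd hd'].
have [|g [mg g0 gs0 gd gi]] := Hd h; first by rewrite h0.
have [|tht inc] := Hd' h; first by rewrite h0.
pose f r := `|(phi \o gam) (r + h)%R - (phi \o gam) r|%:E.
have f0 r : 0 <= f r by rewrite lee_fin.
have mf : measurable_fun `[s, t[ f by exact: (measurable_difference u_meas s0 h0 (ltW tht)).
pose D : set R := `]0%R, (T - h)%R[%classic.
have stD : `[s, t[ `<=` D.
  move=> r /=; rewrite /D/= !in_itv/= => /andP[sr rt].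
  by rewrite (lt_le_trans s0 sr) (lt_trans rt)// ltrBrDr.
have mfD : measurable_fun D (f \_ `[s, t[).
  apply: (measurable_funS measurableT) => //.
  exact/(measurable_restrictT _ _).1.
have fr0 r : 0 <= (f \_ `[s, t[) r by rewrite patchE; case: ifPn.
(* On the new interval [g] vanishes, so the sum is still bounded by one distance and not by two. *)
exists (fun r => g r + (f \_ `[s, t[) r); split.
- exact: emeasurable_funD.
- by move=> r; rewrite adde_ge0.
- move=> r tr; rewrite gs0 ?add0e ?(le_trans (ltW st))// patchE memNset//=.
  by rewrite in_itv/= ltNge tr andbF.
- move=> r rD; rewrite patchE; case: ifPn => [|_]; last by rewrite adde0 gd.
  rewrite inE/= in_itv/= => /andP[sr _]; rewrite gs0// add0e; exact: Lphi.
rewrite ge0_integralD//.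
rewrite -integral_mkcondr (setIidr stD).
apply: le_trans (leeD gi inc); rewrite -EFinD lee_fin.
by rewrite -mulrDl ler_pM2r//=; lra.
Qed.

(** For small [h] the minorant has integral at least [(c - e) * h]; dividing by [h] and using the
    bound on difference quotients gives [c - e <= C]. *)
Let gain_le t c : gain t c -> (c <= C)%R.
Proof.
move=> /gain_integral H; apply/ler_addgt0Pr => e e0.
have [d d0 Hd] := H _ e0.
pose h := (Num.min d T / 2)%R.
have m0 : (0 < Num.min d T)%R by rewrite lt_min d0.
have h0 : (0 < h)%R by rewrite divr_gt0.
have hm : (h < Num.min d T)%R by rewrite ltr_pdivrMr// ltr_pMr// ltr1n.
move: (hm); rewrite lt_min => /andP[hd hT].
have [|g [mg g0 _ gd gi]] := Hd h; first by rewrite h0.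
have Ih : I h by rewrite /I/= in_itv/= h0.
rewrite -lerBlDr -lee_fin; apply: le_trans (HC Ih).
have hV0 : 0 <= (h^-1)%:E by rewrite lee_fin invr_ge0 ltW.
apply: (@le_trans _ _ (\int[mu]_(r in `]0%R, (T - h)%R[) (g r * (h^-1)%:E))).
  rewrite ge0_integralZr//.
  by rewrite lee_pdivlMr// -EFinM.
apply: ge0_integral_le_lower => //.
by move=> r rD; rewrite mule_ge0//= lee_wpmul2r// gd// inE.
Qed.

Lemma weak_bv_of_difference_quotients : weak_bv T gam.
Proof.
pose V t := [set c | gain t c].
have V0 t : V t !=set0 by exists 0%R; exact: gain0.
have hV t : has_sup (V t) by split => //; exists C => c; exact: gain_le.
exists (fun t => sup (V t)), C; split.
  split=> [s t st|t].
    apply: ge_sup => // c sc; apply: ub_le_sup; first by have [] := hV t.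
    exact: gain_mono sc.
  apply/andP; split; last by apply: ge_sup => // c; exact: gain_le.
  by apply: ub_le_sup; [have [] := hV t|exact: gain0].
move=> phi Lphi bphi; have [M bM] := bphi.
have mphi := measurable_Lip1_comp mgam Lphi.
have iphi : mu.-integrable `]0%R, T[ (EFin \o (phi \o gam)).
  apply: measurable_bounded_integrable => //.
  - by rewrite /= lebesgue_measure_itv/=; case: ifPn; rewrite ?ltry.
  - exists M; split; first exact: num_real.
    move=> x Mx y _ /=; have /andP[u0 uM] := bM (gam y); rewrite ger0_norm//.
    by rewrite (le_trans uM)// ltW.
have [N [mN N0 HN]] := ae_right_lebesgue_pt iphi.
exists N; first by exists N; split.
have goodN t : (I `\` N) t -> good phi t.
  move=> [It Nt]; split => //; apply: contrapT => ng.
  by apply/Nt/HN => /= /(_ It).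
(* Any sum of increments on the left of [s] can be followed by the interval from [s] to [t] with the
   test function [phi]. *)
move=> s t As At st; rewrite lee_fin lerBrDl -lerBrDr.
apply: ge_sup => // c sc; rewrite lerBrDr; apply: ub_le_sup.
  by have [] := hV t.
rewrite distrC; apply: gain_step st _ _ _ => //; exact: goodN.
Qed.

End from_difference_quotients.

(** * From bounds on increments to distributional derivatives *)

Section test_functions.
Context {R : realType}.
Variables (T : R) (phi : R -> R).
Let I : set R := `]0%R, T[%classic.
Local Notation mu := (@lebesgue_measure R).
Hypotheses (T_gt0 : (0 < T)%R) (tphi : test_function I phi).

Lemma test_function_derivable t : derivable phi t 1.
Proof. by have [/(_ 0%N t)] := tphi. Qed.

Lemma test_function_continuous : continuous phi.
Proof.
move=> t; apply/differentiable_continuous/derivable1_diffP.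
exact: test_function_derivable.
Qed.

Lemma test_function_derive_continuous : continuous (derive1 phi).
Proof.
move=> t; apply/differentiable_continuous/derivable1_diffP.
by have [/(_ 1%N t)] := tphi.
Qed.

Lemma measurable_test_function_derive (D : set R) : measurable_fun D (derive1 phi).
Proof.
apply: measurable_funTS; apply: continuous_measurable_fun.
exact: test_function_derive_continuous.
Qed.

Lemma test_function_eq0 t : ~ I t -> phi t = 0%R.
Proof. by have [_ [K [_ KI K0]]] := tphi; move=> It; apply: K0 => /KI. Qed.

Lemma integral_test_function_derive x : (x < T)%R ->
  \int[mu]_(t in `[x, T[) (derive1 phi t)%:E = (- phi x)%:E.
Proof.
move=> xT; rewrite -[X in _ = X%:E]add0r -(@test_function_eq0 T); last first.
  by rewrite /I/= in_itv/= ltxx andbF.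
rewrite EFinB -(@continuous_FTC2 _ (derive1 phi) phi x T)//.
- rewrite integral_itv_bndo_bndc//.
  by apply/measurable_EFinP; exact: measurable_test_function_derive.
- by apply: continuous_subspaceT; exact: test_function_derive_continuous.
- split=> [t _| |]; first exact: test_function_derivable.
  + by apply: cvg_at_right_filter; exact: test_function_continuous.
  + by apply: cvg_at_left_filter; exact: test_function_continuous.
Qed.

Lemma integrable_test_function_derive a b :
  mu.-integrable `[a, b] (EFin \o derive1 phi).
Proof.
apply: continuous_compact_integrable; first exact: segment_compact.
by apply: continuous_subspaceT; exact: test_function_derive_continuous.
Qed.

Lemma test_function_bounded : exists M, forall t, (`|phi t| <= M)%R.
Proof.
have : bounded_set (phi @` `[0%R, T]%classic).
  apply: compact_bounded; apply: continuous_compact; last exact: segment_compact.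
  by apply: continuous_subspaceT; exact: test_function_continuous.
move=> [M [Mr HM]]; exists (Num.max (M + 1) 0)%R => t; rewrite le_max.
have [It|/test_function_eq0 ->] := pselect (I t); last by rewrite normr0 lexx orbT.
rewrite HM ?ltrDl//; exists t => //.
by move: It; rewrite /I/= !in_itv/= => /andP[/ltW-> /ltW->].
Qed.

Lemma integrable_test_function (m : {finite_measure set (measurableTypeR R) -> \bar R}) :
  m.-integrable I (EFin \o phi).
Proof.
have [M HM] := test_function_bounded.
apply: measurable_bounded_integrable => //.
- exact: measurable_itv.
- by rewrite ltey_eq fin_num_measure//; exact: measurable_itv.
- apply: measurable_funTS; apply: continuous_measurable_fun.
  exact: test_function_continuous.
- exists M; split; first exact: num_real.
  by move=> x Mx y _ /=; rewrite (le_trans (HM y))// ltW.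
Qed.

Section integration_by_parts.
Variables (F : R -> R) (C : R) (bF : bounded_monotone F C).
Variable m : {finite_measure set (measurableTypeR R) -> \bar R}.
Hypothesis mE : forall a b, (a <= b)%R ->
  m `]a, b]%classic = (rlim F b - rlim F a)%:E.

Let mI : measurable I. Proof. exact: measurable_itv. Qed.

Let below_diagonal : set (R * R) :=
  [set p | (0 < p.2)%R /\ (p.2 <= p.1)%R /\ (p.1 < T)%R].

Let measurable_below_diagonal : measurable below_diagonal.
Proof.
have le (f g : R * R -> R) : measurable_fun setT f -> measurable_fun setT g ->
    measurable [set p | (f p <= g p)%R].
  by move=> mf mg; rewrite -[X in measurable X]setTI; exact: measurable_fun_le.
have -> : below_diagonal = ~` [set p | (p.2 <= 0)%R] `&`
    ([set p | (p.2 <= p.1)%R] `&` ~` [set p | (T <= p.1)%R]).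
  apply/seteqP; split=> p /=; rewrite /below_diagonal/=.
    by move=> [p0 [pp pT]]; split; [|split => //]; apply/negP; rewrite -ltNge.
  by move=> [/negP p0 [pp /negP pT]]; rewrite !ltNge.
apply: measurableI; first by apply: measurableC; exact: le.
by apply: measurableI; [exact: le|apply: measurableC; exact: le].
Qed.

(** Integrated in the second variable against [m], the kernel gives [phi' t] times the mass of the
    interval from [0] to [t]; integrated in the first variable, it gives [- phi x]. Fubini equates
    the two iterated integrals. *)
Let kernel : R * R -> \bar R := (fun p => (derive1 phi p.1)%:E) \_ below_diagonal.

Let measurable_kernel : measurable_fun setT kernel.
Proof.
apply/(measurable_restrictT _ _).1 => //; apply: measurable_funTS.
apply/measurable_EFinP; apply: measurableT_comp => //.
exact: measurable_test_function_derive.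
Qed.

(** The function [G] is later the derivative of [phi] or its absolute value, the latter for
    integrability. *)
Let integral_kernel2 (G : R -> \bar R) (t : R) : I t ->
  \int[m]_x (if (t, x) \in below_diagonal then G t else 0) = G t * m `]0%R, t]%classic.
Proof.
rewrite /I/= in_itv/= => /andP[t0 tT].
rewrite -integral_cst; last exact: measurable_itv.
rewrite [RHS]integral_mkcond; apply: eq_integral => x _; rewrite patchE.
congr (if _ then _ else _); apply/idP/idP; rewrite !inE /below_diagonal/= in_itv/=.
  by move=> [-> [-> _]].
by move=> /andP[-> ->].
Qed.

Let integral_kernel2_out (t : R) : ~ I t ->
  forall x, (t, x) \in below_diagonal = false.
Proof.
move=> It x; apply/negP; rewrite inE => -[/= x0 [xt tT]]; apply: It.
by rewrite /I/= in_itv/= tT (lt_le_trans x0 xt).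
Qed.

Let integral_kernel1 (x : R) : I x -> \int[mu]_t kernel (t, x) = (- phi x)%:E.
Proof.
rewrite /I/= in_itv/= => /andP[x0 xT].
rewrite -integral_test_function_derive// [RHS]integral_mkcond.
apply: eq_integral => t _; rewrite /kernel !patchE.
congr (if _ then _ else _); apply/idP/idP; rewrite !inE /below_diagonal/= in_itv/=.
  by move=> [_ [-> ->]].
by move=> /andP[-> ->].
Qed.

Let integrable_kernel : (mu \x m).-integrable setT kernel.
Proof.
apply: (integrable12ltyP mu m measurable_kernel).2.
apply: (@le_lt_trans _ _ (\int[mu]_(t in I) (`|(derive1 phi t)%:E| * m setT))).
  rewrite [leRHS]integral_mkcond; apply: ge0_le_integral => //.
  - by move=> t _; exact: integral_ge0.
  - apply: (@measurable_fun_fubini_tonelli_F _ _ _ _ _ m (abse \o kernel)) => //=.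
    exact: measurableT_comp.
  - apply/(measurable_restrictT _ _).1 => //; apply: emeasurable_funM => //.
    apply: measurableT_comp => //; apply/measurable_EFinP.
    exact: measurable_test_function_derive.
  move=> t _; rewrite patchE; case: ifPn => [/[!inE] It|/negP].
    have -> : \int[m]_x `|kernel (t, x)| = \int[m]_x (if (t, x) \in below_diagonal
        then `|(derive1 phi t)%:E| else 0).
      by apply: eq_integral => x _; rewrite /kernel patchE; case: ifPn => //=; rewrite normr0.
    rewrite (integral_kernel2 (fun t => `|(derive1 phi t)%:E|) It).
    by rewrite lee_wpmul2l// le_measure ?inE//; exact: measurable_itv.
  rewrite inE => It; rewrite integral0_eq// => x _.
  by rewrite /kernel patchE integral_kernel2_out// abse0.
rewrite ge0_integralZr//; last first.
  apply: measurableT_comp => //; apply/measurable_EFinP.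
  exact: measurable_test_function_derive.
have : mu.-integrable I (EFin \o derive1 phi).
  by apply: integrableS (integrable_test_function_derive 0%R T) => //;
    exact: subset_itv_oo_cc.
move=> /integrableP[_ /= h].
by rewrite lte_mul_pinfty ?integral_ge0// ?ltey_eq ?fin_num_measure// ge0_fin_numE ?integral_ge0.
Qed.

(** Away from its jumps, [F t] is [rlim F 0] plus the mass of the interval from [0] to [t]. The
    constant integrates to zero against the derivative of [phi], and the remaining term is the
    integral of the kernel. *)
Lemma integration_by_parts_monotone :
  \int[mu]_(t in I) (F t * derive1 phi t)%:E = - \int[m]_(t in I) (phi t)%:E.
Proof.
have [ndF bFC] := bF.
have mphi' : measurable_fun I (derive1 phi) by exact: measurable_test_function_derive.
have iphi' : mu.-integrable I (EFin \o derive1 phi).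
  by apply: integrableS (integrable_test_function_derive 0%R T) => //;
    exact: subset_itv_oo_cc.
transitivity (\int[mu]_(t in I) ((rlim F 0)%:E * (derive1 phi t)%:E +
    \int[m]_x kernel (t, x))).
  apply: ae_eq_integral => //.
  - apply/measurable_EFinP; apply: measurable_funM => //.
    exact: nondecreasing_measurable.
  - apply: emeasurable_funD.
      by apply: measurable_funeM; exact/measurable_EFinP.
    by apply: measurable_funTS; exact: (measurable_fubini_F integrable_kernel).
  have [N [mN N0 HN]] := negligible_neq_rlim ndF.
  exists N; split => // t /= ne; apply: HN => /=; apply/eqP => FE; apply: ne => It.
  have -> : \int[m]_x kernel (t, x) = \int[m]_x (if (t, x) \in below_diagonal
      then (derive1 phi t)%:E else 0).
    by apply: eq_integral => x _; rewrite /kernel patchE.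
  rewrite (integral_kernel2 (fun t => (derive1 phi t)%:E) It) mE; last first.
    by move: It; rewrite /I/= in_itv/= => /andP[/ltW].
  by rewrite -FE -!EFinM -EFinD; congr (_%:E); lra.
rewrite integralD//; last 2 first.
- exact: integrableZl.
- by apply: integrableS (integrable_fubini_F integrable_kernel).
rewrite integralZl//.
have -> : \int[mu]_(t in I) (derive1 phi t)%:E = 0.
  rewrite integral_itv_obnd_cbnd; last exact/measurable_EFinP.
  rewrite integral_test_function_derive// test_function_eq0 ?oppr0//.
  by rewrite /I/= in_itv/= ltxx.
rewrite mule0 add0e.
transitivity (\int[mu]_t \int[m]_x kernel (t, x)).
  rewrite integral_mkcond; apply: eq_integral => t _; rewrite patchE.
  case: ifPn => // /negP; rewrite inE => It; rewrite integral0_eq// => x _.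
  by rewrite /kernel patchE integral_kernel2_out.
have := integral12_prod_meas1 integrable_kernel.
have := integral21_prod_meas1 integrable_kernel.
rewrite /fubini_F /fubini_G => <- ->.
rewrite -integralN; last first.
  rewrite fin_num_adde_defl// fin_numN; apply: integrable_neg_fin_num => //.
  exact: integrable_test_function.
rewrite [RHS]integral_mkcond; apply: eq_integral => x _; rewrite patchE.
case: ifPn => [/[!inE] Ix|/negP]; first by rewrite integral_kernel1.
rewrite inE => Ix; rewrite integral0_eq// => t _; rewrite /kernel patchE memNset//.
move=> [/= x0 [xt tT]]; apply: Ix; rewrite /I/= in_itv/= x0/=.
exact: le_lt_trans tT.
Qed.

End integration_by_parts.

End test_functions.

(** * Signed measures as differences of finite measures *)

Section difference_of_measures.
Context {R : realType}.
Local Notation mu := (@lebesgue_measure R).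
Variables m1 m2 : {finite_measure set (measurableTypeR R) -> \bar R}.

Definition measure_difference : {charge set (measurableTypeR R) -> \bar R} :=
  cadd (charge_of_finite_measure m1) (copp (charge_of_finite_measure m2)).

Lemma measure_differenceE A : measure_difference A = m1 A - m2 A.
Proof. by []. Qed.

Variables (P N : set (measurableTypeR R))
  (nuPN : hahn_decomposition measure_difference P N).

Let mP : measurable P. Proof. by have [[]] := nuPN. Qed.
Let mN : measurable N. Proof. by have [_ []] := nuPN. Qed.

Let fin1 A : measurable A -> m1 A \is a fin_num. Proof. exact: fin_num_measure. Qed.
Let fin2 A : measurable A -> m2 A \is a fin_num. Proof. exact: fin_num_measure. Qed.

(** The variation is the charge of the part of [A] in [P] minus that of the part in [N]; dropping
    the subtracted masses leaves at most [m1 A + m2 A]. *)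
Lemma charge_variation_measure_difference A : measurable A ->
  charge_variation nuPN A <= m1 A + m2 A.
Proof.
move=> mA; have mAP : measurable (A `&` P) by exact: measurableI.
have mAN : measurable (A `&` N) by exact: measurableI.
have split_ (m : {finite_measure set (measurableTypeR R) -> \bar R}) :
    m A = m (A `&` P) + m (A `&` N).
  have [_ _ PNT PN0] := nuPN.
  rewrite -measureU//; first by rewrite -setIUr PNT setIT.
  by rewrite setIACA PN0 setI0.
rewrite /charge_variation jordan_posE jordan_negE cjordan_posE cjordan_negE.
rewrite /crestr0 mem_set// /crestr !measure_differenceE.
rewrite (split_ m1) (split_ m2).
have : 0 <= m1 (A `&` N) by exact: measure_ge0.
have : 0 <= m2 (A `&` P) by exact: measure_ge0.
move: (fin1 mAP) (fin1 mAN) (fin2 mAP) (fin2 mAN).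
case: (m1 (A `&` P)) => // a; case: (m1 (A `&` N)) => // b.
case: (m2 (A `&` P)) => // c; case: (m2 (A `&` N)) => // d _ _ _ _.
by rewrite -?EFinN -!EFinD -?EFinN -?EFinD !lee_fin => ? ?; lra.
Qed.

(** The positive part plus [m2] and the negative part plus [m1] are the same measure. Integrating
    against both forms and rearranging finite terms gives the formula. *)
Lemma charge_integral_measure_difference (D : set (measurableTypeR R)) (phi : R -> R) :
  measurable D ->
  (forall m : {finite_measure set (measurableTypeR R) -> \bar R},
    m.-integrable D (EFin \o phi)) ->
  charge_integral nuPN D phi =
  \int[m1]_(t in D) (phi t)%:E - \int[m2]_(t in D) (phi t)%:E.
Proof.
move=> mD iphi; rewrite /charge_integral.
have fi (m : {finite_measure set (measurableTypeR R) -> \bar R}) :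
    \int[m]_(t in D) (phi t)%:E \is a fin_num.
  by apply: integrable_fin_num => //; exact: iphi.
have : \int[measure_add (jordan_pos nuPN) m2]_(t in D) (phi t)%:E =
    \int[measure_add (jordan_neg nuPN) m1]_(t in D) (phi t)%:E.
  apply: eq_measure_integral => A mA _.
  transitivity (jordan_pos nuPN A + m2 A); first exact: measure_addE.
  transitivity (jordan_neg nuPN A + m1 A); last by apply: esym; exact: measure_addE.
  have : m1 A - m2 A = jordan_pos nuPN A - jordan_neg nuPN A.
    rewrite -measure_differenceE (jordan_decomp nuPN mA) /cadd/=.
    by rewrite cscaleN1.
  have jp := fin_num_measure (jordan_pos nuPN) A mA.
  have jn := fin_num_measure (jordan_neg nuPN) A mA.
  rewrite -(fineK jp) -(fineK jn) -(fineK (fin1 mA)) -(fineK (fin2 mA)).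
  by rewrite -!EFinD => -[] e; congr (_%:E); lra.
have mphi : measurable_fun D (EFin \o phi) by exact: measurable_int (iphi m1).
have addE (p q : {finite_measure set (measurableTypeR R) -> \bar R}) :
    \int[measure_add p q]_(t in D) (phi t)%:E =
    \int[p]_(t in D) (phi t)%:E + \int[q]_(t in D) (phi t)%:E.
  by apply: integral_measure_add => //; exact: iphi.
rewrite [X in X = _]addE [X in _ = X]addE.
rewrite -(fineK (fi m1)) -(fineK (fi m2)).
rewrite -(fineK (fi (jordan_pos nuPN))) -(fineK (fi (jordan_neg nuPN))).
by rewrite -!EFinD => -[] ?; congr (_%:E); lra.
Qed.

End difference_of_measures.

Section lipschitz_extension.
Context {R : realType}.
Local Open Scope ring_scope.

(* McShane extension, with respect to the pseudodistance [|F s - F t|]. *)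
Lemma mcshane_extension (A : set R) (u F : R -> R) (C : R) : A !=set0 ->
  (forall x, 0 <= F x <= C) ->
  (forall s t, A s -> A t -> `|u s - u t| <= `|F s - F t|) ->
  exists v : R -> R, (forall t, A t -> v t = u t) /\
    forall s t, `|v s - v t| <= `|F s - F t|.
Proof.
move=> [a Aa] bF uF.
pose V t := [set u s + `|F t - F s| | s in A].
have V0 t : V t !=set0 by exists (u a + `|F t - F a|), a.
have lb_V t s0 : A s0 -> lbound (V t) (u s0 - `|F t - F s0|).
  move=> As0 _ [s As <-]; have := uF s s0 As As0.
  rewrite ler_distlC => /andP[h _]; rewrite lerBlDr.
  have := ler_distD (F t) (F s) (F s0); rewrite (distrC (F s) (F t)) => h2.
  have := uF s s0 As As0; rewrite ler_norml => /andP[h3 _]; lra.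
have hV t : has_inf (V t) by split => //; eexists; exact: lb_V Aa.
exists (fun t => inf (V t)); split=> [t At|s t].
  apply/eqP; rewrite eq_le; apply/andP; split.
    by apply: ge_inf; [have [] := hV t|exists t => //; rewrite subrr normr0 addr0].
  apply: lb_le_inf => //; have := lb_V t t At; by rewrite subrr normr0 subr0.
have le x y : inf (V x) <= inf (V y) + `|F x - F y|.
  rewrite -lerBlDr; apply: lb_le_inf => // _ [z Az <-]; rewrite lerBlDr.
  apply: (@le_trans _ _ (u z + `|F x - F z|)).
    by apply: ge_inf; [have [] := hV x|exists z].
  by rewrite -addrA lerD2l addrC ler_distD.
rewrite ler_norml; have := le s t; have := le t s; rewrite (distrC (F t)).
by move=> ? ?; apply/andP; split; lra.
Qed.

End lipschitz_extension.

Section derivative_of_increments.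
Context {R : realType}.
Variables (T : R) (u F : R -> R) (C : R).
Let I : set R := `]0%R, T[%classic.
Local Notation mu := (@lebesgue_measure R).
Hypotheses (T_gt0 : (0 < T)%R) (u_meas : measurable_fun I u).
Hypotheses (bF : bounded_monotone F C) (uF : ae_increment_le real_dist u I F).
Variable m : {finite_measure set (measurableTypeR R) -> \bar R}.
Hypothesis mE : forall a b, (a <= b)%R ->
  m `]a, b]%classic = (rlim F b - rlim F a)%:E.

(** The extension [v] satisfies the bound at all pairs of times, so that [F + v] and [F - v] are
    monotone on the whole line. *)
Let extension : exists v : R -> R, exists2 N, mu.-negligible N &
  (forall t, (I `\` N) t -> v t = u t) /\
  forall s t, (`|v s - v t| <= `|F s - F t|)%R.
Proof.
have [ndF bF'] := bF.
have [N N0 uFN] := ae_increment_sym uF ndF.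
have [r r0T Nr] := nonnegligible_itv N0 T_gt0.
have [|v [vu vF]] := mcshane_extension _ bF' uFN.
  by exists r; split => //; rewrite /I/= in_itv.
by exists v, N.
Qed.

Lemma BV_function_increment : BV_function I u.
Proof.
have [v [N N0 [vu vF]]] := extension; have [ndF _] := bF.
apply: le_lt_trans (ltry C); apply: (@le_trans _ _ (Var real_dist v I)).
  apply: ereal_inf_lbound; exists v => //=.
  apply: negligibleS N0 => t /= /not_implyP[It vt]; apply: contrapT => Nt.
  by apply: vt; exact: vu.
apply: (Var_le bF) => s t _ _ st; rewrite lee_fin.
by rewrite (le_trans (vF _ _))// ler0_norm ?opprB// subr_le0 ndF// ltW.
Qed.

(** Up to constants [v] is the difference of the nondecreasing functions [(F + v) / 2] and
    [(F - v) / 2], whose sum is [F]. Their Stieltjes measures add up to [m], which therefore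
    dominates the variation of their difference. *)
Lemma derivative_variation_le_increment : derivative_variation_le I u m.
Proof.
have [v [N N0 [vu vF]]] := extension; have [ndF bF'] := bF.
(* This bounds [v]; adding it to both halves makes them nonnegative. *)
pose k := (`|v 0| + C)%R.
have vk t : (`|v t| <= k)%R.
  rewrite /k -[v t](subrK (v 0%R)) (le_trans (ler_normD _ _))// addrC lerD2l.
  rewrite (le_trans (vF _ _))// ler_norml.
  by have := bF' t; have := bF' 0%R => /andP[? ?] /andP[? ?]; apply/andP; split; lra.
pose a t := ((F t + v t) / 2 + k)%R; pose b t := ((F t - v t) / 2 + k)%R.
have vFxy x y : (x <= y -> `|v x - v y| <= F y - F x)%R.
  by move=> xy; rewrite (le_trans (vF _ _))// ler0_norm ?opprB// subr_le0 ndF.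
have nda : {homo a : x y / (x <= y)%R}.
  by move=> x y /vFxy; rewrite ler_norml => /andP[? ?]; rewrite /a; lra.
have ndb : {homo b : x y / (x <= y)%R}.
  by move=> x y /vFxy; rewrite ler_norml => /andP[? ?]; rewrite /b; lra.
have ba : bounded_monotone a (C + (k + k)).
  split => // x; have := vk x; rewrite ler_norml /a => /andP[? ?].
  by have /andP[? ?] := bF' x; apply/andP; split; lra.
have bb : bounded_monotone b (C + (k + k)).
  split => // x; have := vk x; rewrite ler_norml /b => /andP[? ?].
  by have /andP[? ?] := bF' x; apply/andP; split; lra.
have [ma maE] := exists_monotone_measure ba.1 ba.2.
have [mb mbE] := exists_monotone_measure bb.1 bb.2.
have mab A : measurable A -> ma A + mb A = m A.
  move=> mA; transitivity (measure_add ma mb A).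
    by apply: esym; exact: measure_addE.
  apply: eq_finite_measure_ocitv => // [x y xy|x y xy].
    transitivity (ma `]x, y]%classic + mb `]x, y]%classic); first exact: measure_addE.
    transitivity ((rlim F y - rlim F x)%:E); last by apply: esym; exact: mE.
    rewrite maE// mbE// -EFinD; congr (_%:E).
    have ndk : {homo (fun=> k + k)%R : x y / (x <= y :> R)%R} by [].
    have rk z : rlim (fun=> k + k)%R z = (k + k)%R.
      by apply: cvg_lim; [exact: Rhausdorff|exact: cvg_cst].
    have rab z : (rlim a z + rlim b z = rlim F z + (k + k))%R.
      rewrite -rlimD// -[X in (_ + X)%R](rk z) -rlimD//; congr (rlim _ z).
      by apply/funext => w; rewrite /a /b; lra.
    by have := rab x; have := rab y; lra.
  apply: (@le_lt_trans _ _ (ma `]x, y]%classic + mb `]x, y]%classic)).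
    by rewrite le_eqVlt; apply/orP; left; apply/eqP; exact: measure_addE.
  by rewrite maE// mbE// -EFinD ltry.
have [P [Q hPQ]] := Hahn_decomposition (measure_difference ma mb).
exists (measure_difference ma mb), P, Q, hPQ; split; last first.
  move=> A mA _; apply: le_trans (charge_variation_measure_difference hPQ mA) _.
  by rewrite mab.
have mI : measurable I by exact: measurable_itv.
have mv (D : set R) : measurable D -> measurable_fun D v.
  move=> mD; rewrite (_ : v = fun t => a t - b t)%R; last first.
    by apply/funext => t; rewrite /a /b; lra.
  by apply: measurable_funB; exact: nondecreasing_measurable.
have vu_ae : {ae mu, forall t, I t -> v t = u t}.
  apply: negligibleS N0 => t /= /not_implyP[It vt]; apply: contrapT => Nt.
  by apply: vt; exact: vu.
split.
  apply/integrableP; split; first exact/measurable_EFinP.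
  apply: (@le_lt_trans _ _ (\int[mu]_(t in I) (cst k%:E) t)).
    apply: ge0_integral_lower_le => //.
    - by move=> t _; rewrite /= lee_fin (le_trans _ (vk 0%R)).
    - apply: negligibleS vu_ae => t /=; apply: contra_not => vut It.
      by rewrite -(vut It) lee_fin.
  rewrite integral_cst//= lebesgue_measure_itv/=; case: ifPn => _; last by rewrite mule0 ltry.
  by rewrite -EFinD -EFinM ltry.
move=> phi tphi.
rewrite (charge_integral_measure_difference hPQ mI); last first.
  by move=> m'; exact: (integrable_test_function tphi).
have Ea := integration_by_parts_monotone T_gt0 tphi ba maE.
have Eb := integration_by_parts_monotone T_gt0 tphi bb mbE.
have ibd (f : R -> R) K : bounded_monotone f K ->
    mu.-integrable I (fun t => (f t * derive1 phi t)%:E).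
  move=> [ndf bf].
  have iphi' : mu.-integrable I (EFin \o derive1 phi).
    apply: integrableS (integrable_test_function_derive tphi 0%R T) => //.
    exact: subset_itv_oo_cc.
  have mf : measurable_fun I f by exact: nondecreasing_measurable.
  have bdf : [bounded f x | x in I].
    exists K; split; first exact: num_real.
    move=> z Kz y _ /=; have /andP[? fK] := bf y; rewrite ger0_norm//.
    by rewrite (le_trans fK)// ltW.
  have := @integrableMr _ _ _ mu I mI f (EFin \o derive1 phi) mf bdf iphi'.
  by apply: eq_integrable => // x _; rewrite EFinM.
transitivity (\int[mu]_(t in I) ((a t * derive1 phi t)%:E - (b t * derive1 phi t)%:E)).
  apply: ae_eq_integral => //.
  - apply/measurable_EFinP; apply: measurable_funM => //.
    exact: (measurable_test_function_derive tphi).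
  - apply: emeasurable_funB; apply/measurable_EFinP; apply: measurable_funM.
    + exact: nondecreasing_measurable.
    + exact: (measurable_test_function_derive tphi).
    + exact: nondecreasing_measurable.
    + exact: (measurable_test_function_derive tphi).
  - apply: negligibleS vu_ae => t /=; apply: contra_not => vut It.
    by rewrite -(vut It) -EFinB; congr (_%:E); rewrite /a /b; lra.
rewrite integralB//; [|exact: ibd ba|exact: ibd bb].
rewrite Ea Eb.
have fa : \int[ma]_(t in I) (phi t)%:E \is a fin_num.
  by apply: integrable_fin_num => //; exact: integrable_test_function.
have fb : \int[mb]_(t in I) (phi t)%:E \is a fin_num.
  by apply: integrable_fin_num => //; exact: integrable_test_function.
move: (\int[ma]_(t in I) _) (\int[mb]_(t in I) _) fa fb => A B fA fB.
by rewrite fin_num_oppeB ?fB// oppeK.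
Qed.

End derivative_of_increments.

(** * From distributional derivatives to bounds on increments *)

Section smooth_functions.
Context {R : realType}.
Implicit Types (f g : R -> R) (t x : R).
Local Open Scope ring_scope.

(** Differentiability [n] times with explicit derivatives, so that closure under algebraic
    operations follows by induction on [n] without computing iterated derivatives. *)
Fixpoint nsmooth n f : Prop := if n is n'.+1 then
  exists2 f', (forall t, is_derive t 1 f (f' t)) & nsmooth n' f' else True.

Lemma nsmoothW n f : nsmooth n.+1 f -> nsmooth n f.
Proof.
elim: n f => // n IH f [f' ff' nf']; exists f' => //.
exact: IH.
Qed.

Lemma nsmooth_cst n (c : R) : nsmooth n (fun=> c).
Proof.
elim: n c => // n IH c; exists (fun=> 0); last exact: IH.
by move=> t; exact: is_derive_cst.
Qed.

Lemma nsmoothD n f g : nsmooth n f -> nsmooth n g -> nsmooth n (fun x => f x + g x).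
Proof.
elim: n f g => // n IH f g [f' ff' nf'] [g' gg' ng'].
exists (fun x => f' x + g' x); last exact: IH.
by move=> t; exact: is_deriveD.
Qed.

Lemma nsmoothM n f g : nsmooth n f -> nsmooth n g -> nsmooth n (fun x => f x * g x).
Proof.
elim: n f g => // n IH f g nf ng; move: (nf) (ng) => [f' ff' nf'] [g' gg' ng'].
exists (fun x => f x * g' x + g x * f' x).
  by move=> t; exact: is_deriveM.
by apply: nsmoothD; apply: IH => //; exact: nsmoothW.
Qed.

Lemma nsmoothV n f : (forall x, f x != 0) -> nsmooth n f ->
  nsmooth n (fun x => (f x)^-1).
Proof.
move=> f0; elim: n => // n IH nf; have [f' ff' nf'] := nf.
exists (fun x => - 1 * ((f x)^-1 * (f x)^-1) * f' x).
  move=> t; have := is_deriveV (f0 t) (ff' t).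
  by move=> /is_derive_eq; apply; rewrite expr2 invfM /GRing.scale/= !mulN1r !mulNr.
have nV : nsmooth n (fun x => (f x)^-1) by apply: IH; exact: nsmoothW.
by do 2!(apply: nsmoothM => //); [exact: nsmooth_cst|exact: nsmoothM].
Qed.

Lemma nsmooth_affine n f (a b : R) : nsmooth n f -> nsmooth n (fun x => f (a * x + b)).
Proof.
elim: n f => // n IH f [f' ff' nf'].
exists (fun x => a * f' (a * x + b)).
  move=> t; have h : is_derive t 1 (fun x => a * x + b) a.
    have := is_deriveD (is_deriveZ a (is_derive_id t (1 : R))) (is_derive_cst b t (1 : R)).
    by move=> /is_derive_eq; apply; rewrite addr0 /GRing.scale/= mulr1.
  have := @is_derive1_comp _ f (fun x => a * x + b) t _ _ (ff' _) h.
  by move=> /is_derive_eq; apply; rewrite mulrC.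
by apply: nsmoothM; [exact: nsmooth_cst|exact: IH].
Qed.

Lemma nsmooth_derive1n n f : nsmooth n.+1 f ->
  forall t, derivable (derive1n n f) t 1.
Proof.
elim: n f => [f [f' ff' _] t|n IH f [f' ff' nf'] t].
  by have [] := ff' t.
rewrite /derive1n iterSr -/(derive1n n _) (_ : derive1 f = f'); first exact: IH.
by apply/funext => x; rewrite derive1E; have [_ ->] := ff' x.
Qed.

(* The derivative of [flat k] is a combination of [flat k.+2] and [flat k.+1],
   which makes smoothness an induction. *)
Definition flat (k : nat) x : R := if 0 < x then x^-1 ^+ k * expR (- x^-1) else 0.

Lemma flat0 k : flat k 0 = 0. Proof. by rewrite /flat ltxx. Qed.

(** The exponential of [1 / x] dominates the term of degree [k + 1] of its series. The linear bound
    gives continuity at [0]. *)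
Lemma flat_le k x : 0 < x -> `|flat k x| <= k.+1`!%:R * x.
Proof.
move=> x0; rewrite /flat x0 ger0_norm; last first.
  by rewrite mulr_ge0 ?expR_ge0// exprn_ge0// invr_ge0 ltW.
have := @expR_ge1Dxn R x^-1 k; rewrite invr_ge0 (ltW x0) => /(_ isT) h.
have {}h : x^-1 ^+ k.+1 <= k.+1`!%:R * expR x^-1.
  rewrite mulrC -ler_pdivrMr ?ltr0n ?fact_gt0//.
  by apply: le_trans h; rewrite lerDr.
rewrite expRN ler_pdivrMr ?expR_gt0// mulrAC -ler_pdivrMr//.
by rewrite -exprSr.
Qed.

Lemma is_derive_flat k t :
  is_derive t 1 (flat k) (flat k.+2 t - k%:R * flat k.+1 t).
Proof.
have [t0|t0|t0] := ltgtP t 0.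
- rewrite /flat ltNge (ltW t0)/= mulr0 subr0.
  apply: (@near_eq_is_derive _ _ _ (cst 0)).
  near=> x; rewrite ltNge; have -> // : x <= 0.
  by apply: ltW; near: x; exact: lt_nbhsl.
- apply: (@near_eq_is_derive _ _ _ (fun x => x^-1 ^+ k * expR (- x^-1))).
    near=> x; rewrite /flat; have -> // : 0 < x.
    by near: x; exact: lt_nbhsr.
  have tn0 : t != 0 by rewrite gt_eqF.
  have dV := is_deriveV (f := id) tn0 (is_derive_id t (1 : R)).
  have dX := is_deriveX k dV; rewrite exprfctE in dX.
  have dE := @is_derive1_comp _ expR (fun x => - x^-1) t _ _ (is_derive_expR _) (is_deriveN dV).
  have := is_deriveM dX dE.
  move=> /is_derive_eq; apply; rewrite /flat t0 /GRing.scale/=.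
  rewrite -exprVn mulr1 opprK; set i := t^-1; set E := expR (- i).
  case: k {dX} => [|k]; first by rewrite !mul0r mulr0 subr0 addr0; ring.
  by rewrite /= !exprS; ring.
(* At [0] the difference quotient of [flat k] is [flat k.+1], which tends to [0]; this is
   Caratheodory's criterion. *)
- rewrite t0 /flat ltxx mulr0 subr0; apply/is_derive1_caratheodory.
  exists (flat k.+1); split; last by rewrite /flat ltxx.
    move=> z; rewrite ltxx !subr0 /flat; case: ifPn => [z0|_]; last by rewrite mul0r.
    by rewrite exprSr mulrAC mulrVK ?unitfE ?gt_eqF.
  apply/cvgrPdist_le => e e0.
  near=> z; rewrite flat0 sub0r normrN.
  have [z0|z0] := ltP 0 z; last by rewrite /flat ltNge z0/= normr0 ltW.
  apply: (le_trans (flat_le k.+1 z0)).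
  rewrite mulrC -ler_pdivlMr ?ltr0n ?fact_gt0//.
  apply: ltW; near: z; apply: lt_nbhsl.
  by rewrite divr_gt0// ltr0n fact_gt0.
Unshelve. all: by end_near. Qed.

Lemma nsmooth_flat n k : nsmooth n (flat k).
Proof.
elim: n k => // n IH k.
exists (fun t => flat k.+2 t + (- k%:R) * flat k.+1 t).
  by move=> t; rewrite mulNr; exact: is_derive_flat.
by apply: nsmoothD => //; apply: nsmoothM => //; exact: nsmooth_cst.
Qed.

End smooth_functions.

Section smooth_step.
Context {R : realType}.
Implicit Types (x t : R).
Local Open Scope ring_scope.

Lemma flat_gt0 k x : 0 < x -> 0 < flat k x.
Proof. by move=> x0; rewrite /flat x0 mulr_gt0 ?expR_gt0// exprn_gt0// invr_gt0. Qed.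

Lemma flat_eq0 k x : x <= 0 -> flat k x = 0.
Proof. by move=> x0; rewrite /flat ltNge x0. Qed.

Lemma flat_ge0 k x : 0 <= flat k x.
Proof. by case: (ltP 0 x) => [/(flat_gt0 k)/ltW//|/flat_eq0->]. Qed.

Let den x : R := flat 0 x + flat 0 (1 - x).

Let den_gt0 x : 0 < den x.
Proof.
rewrite /den; case: (ltP 0 x) => x0; first by rewrite ltr_wpDr ?flat_ge0 ?flat_gt0.
by rewrite ltr_wpDl ?flat_ge0// flat_gt0// subr_gt0 (le_lt_trans x0).
Qed.

(** The usual smooth transition from [0] to [1] on the unit interval; the denominator is positive
    since [x] or [1 - x] is. *)
Definition smooth_step x : R := flat 0 x / (flat 0 x + flat 0 (1 - x)).

Lemma nsmooth_smooth_step n : nsmooth n smooth_step.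
Proof.
apply: nsmoothM; first exact: nsmooth_flat.
apply: nsmoothV; first by move=> x; exact: lt0r_neq0 (den_gt0 x).
apply: nsmoothD; first exact: nsmooth_flat.
have := @nsmooth_affine R n (flat 0) (-1) 1 (nsmooth_flat n 0).
by under eq_fun do rewrite mulN1r addrC.
Qed.

Lemma smooth_step0 x : x <= 0 -> smooth_step x = 0.
Proof. by move=> x0; rewrite /smooth_step flat_eq0// mul0r. Qed.

Lemma smooth_step1 x : 1 <= x -> smooth_step x = 1.
Proof.
move=> x1; rewrite /smooth_step (@flat_eq0 0 (1 - x)) ?subr_le0// addr0 divff//.
by rewrite gt_eqF// flat_gt0// (lt_le_trans ltr01).
Qed.

Lemma smooth_step_bound x : 0 <= smooth_step x <= 1.
Proof.
rewrite /smooth_step divr_ge0 ?(ltW (den_gt0 x)) ?flat_ge0//=.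
by rewrite ler_pdivrMr ?den_gt0// mul1r lerDl flat_ge0.
Qed.

Lemma derivable_smooth_step x : derivable smooth_step x 1.
Proof. exact: (@nsmooth_derive1n _ 0 _ (nsmooth_smooth_step 1)). Qed.

Lemma continuous_derive_smooth_step : continuous (derive1 smooth_step).
Proof.
move=> x; apply/differentiable_continuous/derivable1_diffP.
exact: (@nsmooth_derive1n _ 1 _ (nsmooth_smooth_step 2)).
Qed.

Lemma derive_smooth_step_eq0 x : x < 0 \/ 1 < x -> derive1 smooth_step x = 0.
Proof.
case=> x0; rewrite derive1E.
  rewrite -(derive_cst (0 : R) x 1); apply: near_eq_derive.
  by near=> y; rewrite smooth_step0//; apply: ltW; near: y; exact: lt_nbhsl.
rewrite -(derive_cst (1 : R) x 1); apply: near_eq_derive.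
by near=> y; rewrite smooth_step1//; apply: ltW; near: y; exact: lt_nbhsr.
Unshelve. all: by end_near. Qed.

Lemma derive_smooth_step_bounded : exists2 K, 0 < K &
  forall x, `|derive1 smooth_step x| <= K.
Proof.
have : bounded_set (derive1 smooth_step @` `[0, 1]%classic).
  apply: compact_bounded; apply: continuous_compact; last exact: segment_compact.
  by apply: continuous_subspaceT; exact: continuous_derive_smooth_step.
move=> [M [Mr HM]]; exists (Num.max (M + 1) 1) => [|x].
  by rewrite lt_max ltr01 orbT.
have [x01|x01] := boolP (x \in `[0, 1]).
  by rewrite le_max HM ?ltrDl//; exists x.
rewrite derive_smooth_step_eq0 ?normr0 ?le_max ?ler01 ?orbT//.
by move: x01; rewrite in_itv/= negb_and -!ltNge => /orP[]; [left|right].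
Qed.

End smooth_step.

(** * Mollification from the right *)

Section mollification.
Context {R : realType}.
Variables (T : R) (u : R -> R).
Let I : set R := `]0%R, T[%classic.
Local Notation mu := (@lebesgue_measure R).
Hypothesis iu : mu.-integrable I (EFin \o u).

Definition step_at (s h x : R) : R := smooth_step (h^-1 * x - s / h).

Lemma nsmooth_step_at n s h : nsmooth n (step_at s h).
Proof. apply: nsmooth_affine; exact: nsmooth_smooth_step. Qed.

Lemma step_at_arg (s h x : R) : h != 0%R -> (h^-1 * x - s / h = (x - s) / h)%R.
Proof. by move=> h0; rewrite mulrBl mulrC. Qed.

Lemma derive_step_at s h x :
  derive1 (step_at s h) x = (h^-1 * derive1 smooth_step (h^-1 * x - s / h))%R.
Proof.
have h' : is_derive x 1%R (fun x => h^-1 * x - s / h)%R (h^-1)%R.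
  have := is_deriveD (is_deriveZ (h^-1)%R (is_derive_id x (1%R : R)))
    (is_derive_cst (- (s / h))%R x (1%R : R)).
  by move=> /is_derive_eq; apply; rewrite addr0 /GRing.scale/= mulr1.
rewrite derive1E.
have := @is_derive1_comp _ smooth_step (fun x => h^-1 * x - s / h)%R x _ _
  (derivableP (@derivable_smooth_step R _)) h'.
by move=> [_ ->]; rewrite derive1E mulrC.
Qed.

(** The derivative of the step has integral 1 and size at most [K / h], and lives near the right of
    [s]. Hence the error is at most [K / h] times the integral of [u - u s] in absolute value there,
    which is small at a right Lebesgue point. *)
Lemma mollified_value (s e : R) : I s -> right_lebesgue_pt u s -> (0 < e)%R ->
  exists2 d, (0 < d)%R & forall h, (0 < h < d)%R -> [/\ (s + h < T)%R,
    mu.-integrable I (fun y => (u y * derive1 (step_at s h) y)%:E) &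
    exists2 v, \int[mu]_(y in I) (u y * derive1 (step_at s h) y)%:E = v%:E &
      (`|v - u s| <= e)%R].
Proof.
move=> Is us e0; have [s0 sT] : (0 < s)%R /\ (s < T)%R.
  by move: Is; rewrite /I/= in_itv/= => /andP[].
have [K K0 HK] := @derive_smooth_step_bounded R.
have mI : measurable I by exact: measurable_itv.
(* Chosen so that [K / h] times this constant times the window length [2h] equals [e]. *)
have eK : (0 < e / (K *+ 2))%R by rewrite divr_gt0// mulrn_wgt0.
have [d d0 Hd] := us _ eK.
exists (Num.min (d / 2) ((T - s) / 2))%R.
  by rewrite lt_min !divr_gt0// subr_gt0.
move=> h /andP[h0]; rewrite lt_min => /andP[hd hT].
have shT : (s + h < T)%R.
  by rewrite -ltrBrDl (lt_le_trans hT)// ler_pdivrMr// ler_peMr ?subr_ge0 ?ltW// ltr1n.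
have s2hT : (s + h *+ 2 < T)%R.
  by rewrite -ltrBrDl -mulr_natr -ltr_pdivlMr.
set w : R -> R := derive1 (step_at s h).
have cw : continuous w.
  move=> x; apply/differentiable_continuous/derivable1_diffP.
  exact: (@nsmooth_derive1n _ 1 _ (nsmooth_step_at 2 s h)).
have mw (D : set R) : measurable_fun D w.
  by apply: measurable_funTS; exact: continuous_measurable_fun.
have wK y : (`|w y| <= K / h)%R.
  rewrite /w derive_step_at normrM ger0_norm ?invr_ge0 ?(ltW h0)// mulrC.
  by rewrite ler_wpM2r ?invr_ge0 ?(ltW h0).
have bw : [bounded w x | x in I].
  exists (K / h)%R; split; first exact: num_real.
  by move=> z Kz y _ /=; rewrite (le_trans (wK y))// ltW.
(* The vanishing of the derivative is known strictly beyond [s + h]; the half-open window of length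
   [2h] contains the endpoint [s + h]. *)
have w0 y : ~ (s <= y < s + h *+ 2)%R -> w y = 0%R.
  move=> ys; rewrite /w derive_step_at derive_smooth_step_eq0 ?mulr0//.
  rewrite step_at_arg ?gt_eqF// pmulr_llt0 ?invr_gt0// subr_lt0 ltr_pdivlMr// mul1r.
  have [ys'|sy] := ltP y s; [by left|right].
  rewrite ltrBrDl; apply: contrapT => /negP; rewrite -leNgt => yh; apply: ys.
  by rewrite sy/= (le_lt_trans yh)// ltrD2l mulr2n ltrDl.
have iuw : mu.-integrable I (fun y => (u y * w y)%:E).
  have := @integrableMr _ _ _ mu I mI w (EFin \o u) (mw I) bw iu.
  by apply: eq_integrable => // y _; rewrite mulrC EFinM.
have iw : mu.-integrable I (EFin \o w).
  have muI : mu I < +oo by rewrite /I lebesgue_measure_itv/=; case: ifPn; rewrite ?ltry.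
  by apply: measurable_bounded_integrable; [exact: mI|exact: muI|exact: mw|exact: bw].
have int_w : \int[mu]_(y in I) (w y)%:E = 1.
  rewrite integral_itv_obnd_cbnd; last exact/measurable_EFinP.
  rewrite integral_itv_bndo_bndc; last exact/measurable_EFinP.
  rewrite (@continuous_FTC2 _ w (step_at s h))//.
  - rewrite /step_at smooth_step1 ?smooth_step0 ?subr0 ?sube0//.
      rewrite mulr0 sub0r oppr_le0 divr_ge0// ltW//.
    by rewrite step_at_arg ?gt_eqF// ler_pdivlMr// mul1r lerBrDl ltW.
  - exact: lt_trans sT.
  - by apply: continuous_subspaceT.
  - have der x : derivable (step_at s h) x 1%R.
      exact: (@nsmooth_derive1n _ 0 _ (nsmooth_step_at 1 s h)).
    have cs : continuous (step_at s h).
      by move=> x; exact/differentiable_continuous/derivable1_diffP.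
    split=> // ; first by apply: cvg_at_right_filter; exact: cs.
    by apply: cvg_at_left_filter; exact: cs.
have iuw' : mu.-integrable I (fun y => ((u y - u s) * w y)%:E).
  have ic : mu.-integrable I (fun y => (u s)%:E * (w y)%:E) by exact: integrableZl.
  have : mu.-integrable I (fun y => (u y * w y)%:E - (u s)%:E * (w y)%:E).
    exact: integrableB.
  by apply: eq_integrable => // y _; rewrite mulrBl EFinB EFinM.
split => //.
have fin : \int[mu]_(y in I) (u y * w y)%:E \is a fin_num.
  by apply: integrable_fin_num; [exact: mI|exact: iuw].
exists (fine (\int[mu]_(y in I) (u y * w y)%:E)); first by rewrite fineK.
rewrite -lee_fin -abse_EFin EFinB fineK//.
have -> : \int[mu]_(y in I) (u y * w y)%:E - (u s)%:E =
    \int[mu]_(y in I) ((u y - u s) * w y)%:E.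
  rewrite -[X in _ - X]mule1 -int_w -integralZl//.
  rewrite -integralB//; last exact: integrableZl.
  by apply: eq_integral => y _; rewrite -EFinM -EFinB mulrBl.
apply: (le_trans (le_abse_integral _ _ _)) => //; first exact: measurable_int iuw'.
pose J : set R := `[s, (s + h *+ 2)%R[%classic.
have JI : J `<=` I.
  move=> y; rewrite /J /I /= !in_itv/= => /andP[sy ys].
  by rewrite (lt_le_trans s0)//= (lt_trans ys).
have muI : measurable_fun I u by have /integrableP[/measurable_EFinP] := iu.
have mJ : measurable_fun J (fun y => `|u y - u s|%:E).
  apply/measurable_EFinP; apply: measurableT_comp => //; apply: measurable_funB => //.
  exact: measurable_funS muI.
apply: (@le_trans _ _ (\int[mu]_(y in J) ((K / h)%:E * `|u y - u s|%:E))).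
  rewrite integral_mkcond [leRHS]integral_mkcond; apply: ge0_le_integral => //.
  - by move=> y _; rewrite patchE; case: ifPn.
  - apply/(measurable_restrictT _ _).1 => //.
    by apply: measurableT_comp => //; exact: measurable_int iuw'.
  - apply/(measurable_restrictT _ _).1 => //; first exact: measurable_itv.
    exact: measurable_funeM.
  move=> y _; rewrite !patchE; case: ifPn => yI; case: ifPn => yJ //=.
  - by rewrite -EFinM lee_fin normrM mulrC ler_wpM2r.
  - rewrite w0 ?mulr0 ?normr0//.
    by move: yJ; rewrite notin_setE /J/= in_itv/=.
  - by rewrite mule_ge0// lee_fin divr_ge0// ltW.
have mJ0 : measurable J by exact: measurable_itv.
rewrite ge0_integralZl//; last by rewrite lee_fin divr_ge0// ltW.
have h2 : (0 < h *+ 2 < d)%R by rewrite mulrn_wgt0//= -mulr_natr -ltr_pdivlMr.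
apply: (@le_trans _ _ ((K / h)%:E * (e / (K *+ 2) * (h *+ 2))%:E)).
  by rewrite lee_wpmul2l ?Hd// lee_fin divr_ge0// ltW.
rewrite -EFinM lee_fin -(mulr_natr K) -(mulr_natr h).
have -> // : (K / h * (e / (K * 2) * (h * 2)) = e)%R.
by field; rewrite !gt_eqF.
Qed.

End mollification.

Section from_distributional_derivative.
Context {R : realType}.
Variable T : R.
Let I : set R := `]0%R, T[%classic.
Local Notation mu := (@lebesgue_measure R).

Lemma charge_integral_le (nu : {charge set (measurableTypeR R) -> \bar R})
    (P N : set (measurableTypeR R)) (nuPN : hahn_decomposition nu P N)
    (J : set (measurableTypeR R)) (phi : R -> R) :
  measurable J -> J `<=` I -> measurable_fun setT phi ->
  (forall x, 0 <= phi x <= 1)%R -> (forall x, ~ J x -> phi x = 0%R) ->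
  `|charge_integral nuPN I phi| <= charge_variation nuPN J.
Proof.
move=> mJ JI mphi bphi phi0.
have bound (m : {finite_measure set (measurableTypeR R) -> \bar R}) :
    0 <= \int[m]_(t in I) (phi t)%:E <= m J.
  apply/andP; split.
    by apply: integral_ge0 => t _; rewrite lee_fin; have /andP[] := bphi t.
  rewrite integral_mkcond -[leRHS]mul1e -integral_cst// [leRHS]integral_mkcond.
  apply: ge0_le_integral => //.
  - move=> t _; rewrite patchE; case: ifPn => // _.
    by rewrite lee_fin; have /andP[] := bphi t.
  - apply/(measurable_restrictT _ _).1; first exact: measurable_itv.
    by apply/measurable_EFinP; exact: measurable_funTS.
  - by apply/(measurable_restrictT _ _).1.
  move=> t _; rewrite !patchE; case: ifPn => tI; case: ifPn => tJ //=.
  - by rewrite lee_fin; have /andP[] := bphi t.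
  - by rewrite phi0//; move: tJ; rewrite notin_setE.
have /andP[p0 pJ] := bound (jordan_pos nuPN).
have /andP[n0 nJ] := bound (jordan_neg nuPN).
apply: le_trans (leeD pJ nJ); apply: le_trans (lee_abs_sub _ _) _.
by rewrite gee0_abs// gee0_abs.
Qed.

(** The function rises between [s] and [s + h] and falls between [t] and [t + h]; since [h < t - s],
    the rise is over before the fall begins. *)
Lemma test_function_step (s t h : R) : (0 < s)%R -> (t + h < T)%R ->
  (0 < h)%R -> (h < t - s)%R ->
  let phi x := (step_at s h x - step_at t h x)%R in
  [/\ test_function I phi, forall x, (0 <= phi x <= 1)%R,
      forall x, ~ (s < x <= t + h)%R -> phi x = 0%R &
      measurable_fun setT phi].
Proof.
move=> s0 thT h0 hts phi.
have hn0 : h != 0%R by rewrite gt_eqF.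
have step_out (a x : R) : (x <= a)%R -> step_at a h x = 0%R.
  move=> xa; rewrite /step_at smooth_step0// step_at_arg//.
  by rewrite pmulr_lle0 ?invr_gt0// subr_le0.
have step_in (a x : R) : (a + h <= x)%R -> step_at a h x = 1%R.
  move=> xa; rewrite /step_at smooth_step1// step_at_arg//.
  by rewrite ler_pdivlMr// mul1r lerBrDl.
have step_b (a x : R) : (0 <= step_at a h x <= 1)%R by exact: smooth_step_bound.
have sm n : nsmooth n phi.
  have -> : phi = (fun x => step_at s h x + (-1) * step_at t h x)%R.
    by apply/funext => x; rewrite mulN1r.
  apply: nsmoothD; first exact: nsmooth_step_at.
  by apply: nsmoothM; [exact: nsmooth_cst|exact: nsmooth_step_at].
have out x : ~ (s < x <= t + h)%R -> phi x = 0%R.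
  move=> sxt; rewrite /phi; have [xs|sx] := leP x s.
    rewrite step_out// step_out ?subrr// (le_trans xs)//; lra.
  have [xth|xth] := leP x (t + h)%R; first by exfalso; apply: sxt; rewrite sx.
  by rewrite !step_in ?subrr//; lra.
split => //.
- split=> [n x|]; first exact: nsmooth_derive1n.
  exists `[s, (t + h)%R]%classic; split; first exact: segment_compact.
    move=> x; rewrite /I/= !in_itv/= => /andP[sx xt].
    by rewrite (lt_le_trans s0)//= (le_lt_trans xt).
  move=> x /=; rewrite in_itv/= => sxt; apply: out => /andP[sx xt]; apply: sxt.
  by rewrite xt (ltW sx).
- move=> x; rewrite /phi; have [xt|tx] := leP x t.
    by rewrite (step_out t)// subr0.
  rewrite (step_in s); last by lra.
  by have /andP[? ?] := step_b t x; apply/andP; split; lra.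
- apply: continuous_measurable_fun => x.
  apply/differentiable_continuous/derivable1_diffP.
  exact: (@nsmooth_derive1n _ 0 _ (sm 1%N)).
Qed.

(** Tested with the smoothed indicator, [u] gives [u s - u t] up to two errors [e / 3], one for each
    mollified value. The charge gives at most the mass of the interval from [s] to [t + h], which is
    [F t - F s] up to a third [e / 3] because [t] is not a jump. *)
Lemma derivative_variation_increment (u : R -> R)
    (m : {finite_measure set (measurableTypeR R) -> \bar R}) :
  derivative_variation_le I u m ->
  ae_increment_le real_dist u I (distribution_function m).
Proof.
move=> [nu [P [Q [nuPQ [[iu ibp] vle]]]]].
have [ndF bF] := bounded_monotone_distribution_function m.
set F := distribution_function m in ndF bF *.
have [N1 [mN1 N10 HN1]] := ae_right_lebesgue_pt iu.
exists (N1 `|` [set x | F x != rlim F x]).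
  by apply: negligibleU (negligible_neq_rlim ndF); exists N1; split.
move=> s t [Is nNs] [It nNt] st.
have us : right_lebesgue_pt u s.
  by apply: contrapT => ns; apply: nNs; left; apply: HN1 => /= /(_ Is).
have ut : right_lebesgue_pt u t.
  by apply: contrapT => ns; apply: nNt; left; apply: HN1 => /= /(_ It).
have Ft : rlim F t = F t.
  by apply/eqP; apply: contrapT => /negP tF; apply: nNt; right; rewrite /= eq_sym.
have [s0 sT] : (0 < s)%R /\ (s < T)%R by move: Is; rewrite /I/= in_itv/= => /andP[].
rewrite lee_fin; apply/ler_addgt0Pr => e e0.
have e3 : (0 < e / 3)%R by rewrite divr_gt0.
have [ds ds0 Hs] := mollified_value iu Is us e3.
have [dt dt0 Ht] := mollified_value iu It ut e3.
have := cvg_rlim (x := t) ndF; rewrite Ft => /cvgrPdist_le/(_ _ e3)[d /= d0 Hd].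
pose h := (Num.min (Num.min ds dt) (Num.min (t - s) d) / 2)%R.
have m0 : (0 < Num.min (Num.min ds dt) (Num.min (t - s) d))%R.
  by rewrite !lt_min ds0 dt0 d0 subr_gt0 st.
have h0 : (0 < h)%R by rewrite divr_gt0.
have : (h < Num.min (Num.min ds dt) (Num.min (t - s) d))%R.
  by rewrite ltr_pdivrMr// ltr_pMr// ltr1n.
rewrite !lt_min => /andP[/andP[hds hdt] /andP[hts hd]].
have [|shT is_ [vs Es us_]] := Hs h; first by rewrite h0.
have [|thT it_ [vt Et ut_]] := Ht h; first by rewrite h0.
have [tphi bphi phi0 mphi] := test_function_step s0 thT h0 hts.
set phi := (fun x => step_at s h x - step_at t h x)%R in tphi bphi phi0 mphi.
pose J : set R := `]s, (t + h)%R]%classic.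
have JI : J `<=` I.
  move=> x; rewrite /J /I/= !in_itv/= => /andP[sx xt].
  by rewrite (lt_trans s0 sx) (le_lt_trans xt).
have mJ : measurable (J : set (measurableTypeR R)) by exact: measurable_itv.
have phiJ x : ~ J x -> phi x = 0%R by rewrite /J/= in_itv/=; exact: phi0.
have := le_trans (charge_integral_le nuPQ mJ JI mphi bphi phiJ) (vle J mJ JI).
rewrite [leRHS](distribution_functionB m); last by lra.
have d1 (a x : R) : derivable (step_at a h) x 1%R.
  exact: (@nsmooth_derive1n _ 0 _ (nsmooth_step_at 1 a h)).
have E : \int[mu]_(x in I) (u x * derive1 phi x)%:E = vs%:E - vt%:E.
  rewrite -Es -Et -integralB; [|exact: measurable_itv|exact: is_|exact: it_].
  apply: eq_integral => x _; rewrite -EFinB -mulrBr; congr (_ * _)%:E.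
  by rewrite !derive1E deriveB.
have := ibp _ tphi; rewrite E => {}E.
rewrite -abseN -E.
have Fth : (F (t + h) <= F t + e / 3)%R.
  have := Hd (t + h)%R; rewrite /= opprD addNKr normrN gtr0_norm// => /(_ hd).
  by rewrite ltrDl => /(_ h0); rewrite ler_norml => /andP[? ?]; lra.
rewrite -EFinB lee_fin -/F.
move: us_ ut_ => /ler_normlP[? ?] /ler_normlP[? ?] /ler_normlP[? ?].
by apply/ler_normlP; split; lra.
Qed.

End from_distributional_derivative.

(** * The cadlag representative *)

Section right_open_sets.
Context {R : realType}.

(** The points of [V] outside its interior are countable: each starts an open interval inside the
    interior, and rationals chosen in these intervals are distinct. This gives measurability of
    right-continuous maps into an arbitrary [X]. *)
Lemma right_open_measurable (V : set R) :
  (forall t, V t -> exists2 e, (0 < e)%R & forall s, (t < s < t + e)%R -> V s) ->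
  measurable V.
Proof.
move=> rV.
have oV t e : (0 < e)%R -> (forall s, (t < s < t + e)%R -> V s) ->
    `]t, (t + e)%R[%classic `<=` interior V.
  move=> e0 tV s ts; apply: (@interiorS _ `]t, (t + e)%R[%classic).
    by move=> r /=; rewrite in_itv/=; exact: tV.
  by have /interior_id -> : open `]t, (t + e)%R[%classic by exact: interval_open.
have -> : V = interior V `|` (V `\` interior V).
  by rewrite setDUK//; exact: interior_subset.
apply: measurableU; first by apply: open_measurable; exact: open_interior.
have q t : {q : rat | (V `\` interior V) t -> (t < ratr q)%R /\
    forall s, (t < s <= ratr q)%R -> interior V s}.
  apply: cid; have [Vt|nVt] := pselect ((V `\` interior V) t); last by exists 0%R.
  have [e e0 tV] := rV t Vt.1.
  have [|q] := @rat_in_itvoo _ t (t + e)%R; first by rewrite ltrDl.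
  rewrite in_itv/= => /andP[tq qe]; exists q => _; split => // s /andP[ts sq].
  by apply: (oV _ _ e0 tV); rewrite /= in_itv/= ts (le_lt_trans sq).
apply: countable_measurable; first exact: measurable_set1.
apply/countable_injP; exists (fun t => pickle (sval (q t))).
have le s t : (V `\` interior V) s -> (V `\` interior V) t ->
    sval (q s) = sval (q t) -> ~ (s < t)%R.
  move=> Vs Vt e st; have [_ h] := svalP (q s) Vs; have [tq _] := svalP (q t) Vt.
  by apply: Vt.2; apply: h; rewrite st e ltW.
move=> s t; rewrite !inE => Vs Vt /(pcan_inj pickleK) e.
apply/eqP; rewrite eq_le !leNgt; apply/andP; split; apply/negP; exact: le.
Qed.

End right_open_sets.

Section cadlag_representative.
Context {R : realType} {X : extMetricType R}.
Variables (T : R) (gam : R -> X) (F : R -> R) (C : R) (N : set R).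
Let I : set R := `]0%R, T[%classic.
Local Notation mu := (@lebesgue_measure R).
Hypotheses (cX : seq_complete X) (bF : bounded_monotone F C).
Hypotheses (N0 : mu.-negligible N) (gF : increment_le extdist gam (I `\` N) F).

Let ndF : {homo F : x y / (x <= y)%R}. Proof. by have [] := bF. Qed.
Let G := rlim F.

Let gF_sym s t : (I `\` N) s -> (I `\` N) t ->
  extdist (gam s) (gam t) <= `|F s - F t|%:E.
Proof.
move=> As At; have [st|ts|->] := ltgtP s t.
- apply: le_trans (gF As At st) _; rewrite lee_fin distrC; exact: ler_norm.
- rewrite extdist_sym; apply: le_trans (gF At As ts) _; rewrite lee_fin; exact: ler_norm.
- by rewrite (extdist_eq0 _ _).2// lee_fin.
Qed.

Let limit_along (r : nat -> R) (L : R) : (forall n, (I `\` N) (r n)) ->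
  F (r n) @[n --> \oo] --> L ->
  exists x : X, gam (r n) @[n --> \oo] --> x.
Proof.
move=> Ar FL; apply: cX; apply: cauchy_exP => e e0.
have e4 : (0 < e / 4)%R by rewrite divr_gt0.
have /cvgrPdist_lt/(_ _ e4)[n _ Hn] := FL.
exists (gam (r n)); exists n => // m nm /=; rewrite ballE_extdist/=.
apply: le_lt_trans (gF_sym (Ar n) (Ar m)) _; rewrite lte_fin.
have := Hn n (leqnn n); have := Hn m nm.
by rewrite /= !ltr_norml => /andP[? ?] /andP[? ?]; apply/andP; split; lra.
Qed.

Let limit_dist (r : nat -> R) (x y : X) (K : R) : gam (r n) @[n --> \oo] --> x ->
  (\forall n \near \oo, extdist (gam (r n)) y <= K%:E) -> extdist x y <= K%:E.
Proof.
move=> rx rK; apply/lee_addgt0Pr => e e0.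
have /cvg_ballP/(_ _ e0) := rx.
move=> /(filterI rK)/filter_ex[n [nK]]; rewrite /= ballE_extdist/= => xn.
apply: le_trans (extdist_triangle (gam (r n)) _ _) _.
by rewrite addeC leeD// ltW.
Qed.

Let good_between (a b : R) : (0 <= a)%R -> (a < b)%R -> (b <= T)%R ->
  exists2 r, (a < r < b)%R & (I `\` N) r.
Proof.
move=> a0 ab bT; have [r rab Nr] := nonnegligible_itv N0 ab.
exists r => //; split => //; rewrite /I/= in_itv/=.
by move: rab => /andP[ar rb]; rewrite (le_lt_trans a0 ar) (lt_le_trans rb).
Qed.

(** The right limit is recorded by its distance to every later good time, the form in which it is
    used to compare values of the representative. *)
Let right_limit (t : R) : I t -> exists x, forall s, (I `\` N) s -> (t < s)%R ->
  extdist x (gam s) <= (F s - G t)%:E.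
Proof.
rewrite /I/= in_itv/= => /andP[t0 tT].
have /choice[r Hr] : forall n : nat, exists r,
    (t < r < t + (T - t) / n.+1%:R)%R /\ (I `\` N) r.
  move=> n; have [||r tr Ar] := @good_between t (t + (T - t) / n.+1%:R)%R (ltW t0).
  - by rewrite ltrDl divr_gt0// subr_gt0.
  - by rewrite -lerBrDl ler_pdivrMr// ler_peMr ?ler1n// subr_ge0 ltW.
  by exists r.
have rt s : (t < s)%R -> \forall n \near \oo, (r n < s)%R.
  move=> ts; have e0 : (0 < (s - t) / (T - t))%R by rewrite divr_gt0// subr_gt0.
  near=> n; have [/andP[_ rn] _] := Hr n; apply: (lt_trans rn).
  rewrite -ltrBrDl mulrC -ltr_pdivlMr ?subr_gt0//; near: n.
  exact: (near_infty_natSinv_lt (PosNum e0)).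
have Fr : F (r n) @[n --> \oo] --> G t.
  apply/cvgrPdist_le => e e0.
  have /cvgrPdist_le/(_ _ e0)[d /= d0 Hd] := cvg_rlim (x := t) ndF.
  near=> n; have [/andP[tr _] _] := Hr n; apply: Hd => //=.
  rewrite distrC gtr0_norm ?subr_gt0// ltrBlDl; near: n.
  by apply: rt; rewrite ltrDl.
have [x rx] := limit_along (fun n => (Hr n).2) Fr.
exists x => s As ts; apply: (limit_dist rx).
near=> n.
have rs : (r n < s)%R by near: n; exact: rt.
apply: le_trans (gF (Hr n).2 As rs) _; rewrite lee_fin lerB// rlim_le//.
by have [/andP[]] := Hr n.
Unshelve. all: by end_near. Qed.

Let left_limit (t : R) : I t -> exists x, forall s, (I `\` N) s -> (s < t)%R ->
  extdist x (gam s) <= (sup [set F r | r in `]-oo, t[] - F s)%:E.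
Proof.
rewrite /I/= in_itv/= => /andP[t0 tT].
have /choice[r Hr] : forall n : nat, exists r,
    (t - t / n.+1%:R < r < t)%R /\ (I `\` N) r.
  move=> n; have [|||r tr Ar] := @good_between (t - t / n.+1%:R)%R t.
  - by rewrite subr_ge0 ler_pdivrMr// ler_peMr ?ler1n// ltW.
  - by rewrite ltrBlDr ltrDl divr_gt0.
  - exact: ltW.
  by exists r.
set L := sup _.
have supL : has_sup [set F r | r in `]-oo, t[].
  split; first by exists (F (t - 1)), (t - 1)%R => //=; rewrite in_itv/= ltrBlDr ltrDl.
  by exists C => _ [s _ <-]; have [_ /(_ s)/andP[]] := bF.
have FL s : (s < t)%R -> (F s <= L)%R.
  by move=> st; apply: ub_le_sup; [exact: supL.2|exists s => //=; rewrite in_itv].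
have rt s : (s < t)%R -> \forall n \near \oo, (s < r n)%R.
  move=> st; have e0 : (0 < (t - s) / t)%R by rewrite divr_gt0// subr_gt0.
  near=> n; have [/andP[rn _] _] := Hr n; apply: lt_trans rn.
  rewrite ltrBrDr -ltrBrDl mulrC -ltr_pdivlMr//; near: n.
  exact: (near_infty_natSinv_lt (PosNum e0)).
have Fr : F (r n) @[n --> \oo] --> L.
  apply/cvgrPdist_le => e e0.
  have [_ [s + <-] Ls] := sup_adherent e0 supL.
  rewrite /= in_itv/= => st; near=> n.
  have sr : (s < r n)%R by near: n; exact: rt.
  have rtn : (r n < t)%R by have [/andP[]] := Hr n.
  rewrite ger0_norm ?subr_ge0 ?FL// lerBlDr -lerBlDl (le_trans (ltW Ls))//.
  by rewrite ndF// ltW.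
have [x rx] := limit_along (fun n => (Hr n).2) Fr.
exists x => s As st; apply: (limit_dist rx).
near=> n.
have sr : (s < r n)%R by near: n; exact: rt.
rewrite extdist_sym; apply: le_trans (gF As (Hr n).2 sr) _.
by rewrite lee_fin lerB// FL//; have [/andP[]] := Hr n.
Unshelve. all: by end_near. Qed.

Let ge0_in_I t : I t -> (0 <= t)%R /\ (t < T)%R.
Proof. by rewrite /I/= in_itv/= => /andP[/ltW]. Qed.

(** The extra null set [N'] allows the time [r] to be chosen where a competing representative also
    agrees with [gam]. *)
Let good_right N' t b e : mu.-negligible N' -> I t -> (t < b)%R -> (b <= T)%R ->
  (0 < e)%R ->
  exists r, [/\ (t < r < b)%R, (I `\` N) r, ~ N' r & (F r <= G t + e)%R].
Proof.
move=> N'0 It tb bT e0; have [t0 tT] := ge0_in_I It.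
have /cvgrPdist_le/(_ _ e0)[d /= d0 Hd] := cvg_rlim (x := t) ndF.
have tb' : (t < Num.min b (t + d))%R by rewrite lt_min tb ltrDl.
have [r /andP[tr]] := nonnegligible_itv (negligibleU N0 N'0) tb'.
rewrite lt_min => /andP[rb rd] /not_orP[Nr N'r]; exists r; split => //.
- by rewrite tr rb.
- split=> //; rewrite /I/= in_itv/= (le_lt_trans t0 tr)/=.
  exact: lt_le_trans rb bT.
- have := Hd r; rewrite /= distrC gtr0_norm ?subr_gt0// ltrBlDl => /(_ rd tr).
  by rewrite distrC ler_norml => /andP[_]; rewrite lerBlDl.
Qed.

Let right_limit_curve : exists g : R -> X, forall t, I t ->
  forall s, (I `\` N) s -> (t < s)%R -> extdist (g t) (gam s) <= (F s - G t)%:E.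
Proof.
have /choice[g Hg] : forall t, exists x, I t -> forall s, (I `\` N) s ->
    (t < s)%R -> extdist x (gam s) <= (F s - G t)%:E.
  move=> t; have [/right_limit[x Hx]|nIt] := pselect (I t); first by exists x.
  by exists (gam t).
by exists g.
Qed.

Section properties.
Variable g : R -> X.
Hypothesis g_gam : forall t, I t -> forall s, (I `\` N) s -> (t < s)%R ->
  extdist (g t) (gam s) <= (F s - G t)%:E.

(** For a good time [r] just after [t], the two distances to [gam r] add up to at most
    [(F r - G s) + (F r - G t)], and [F r] is close to [G t]. *)
Let increment_limit : increment_le extdist g I G.
Proof.
move=> s t Is It st; apply/lee_addgt0Pr => e e0.
have e2 : (0 < e / 2)%R by rewrite divr_gt0.
have [r [/andP[tr _] Ar _ Fr]] :=
  good_right (negligible_set0 mu) It (ge0_in_I It).2 (lexx _) e2.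
apply: le_trans (extdist_triangle (gam r) _ _) _; rewrite [X in _ + X]extdist_sym.
apply: le_trans (leeD (g_gam Is Ar (lt_trans st tr)) (g_gam It Ar tr)) _.
by rewrite -!EFinD lee_fin; lra.
Qed.

Let ae_limit_eq : {ae mu, forall t, I t -> g t = gam t}.
Proof.
have := negligibleU N0 (negligible_neq_rlim ndF).
apply: negligibleS => t /= /not_implyP[It gt]; apply: contrapT => /not_orP[Nt /negP].
rewrite negbK => /eqP FG; apply: gt; apply/extdist_eq0/eqP.
rewrite eq_le extdist_ge0 andbT; apply/lee_addgt0Pr => e e0; rewrite add0e.
have e2 : (0 < e / 2)%R by rewrite divr_gt0.
have [r [/andP[tr _] Ar _ Fr]] :=
  good_right (negligible_set0 mu) It (ge0_in_I It).2 (lexx _) e2.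
have At : (I `\` N) t by [].
apply: le_trans (extdist_triangle (gam r) _ _) _; rewrite [X in _ + X]extdist_sym.
apply: le_trans (leeD (g_gam It Ar tr) (gF At Ar tr)) _.
rewrite -!EFinD lee_fin FG -/G; lra.
Qed.

Let limit_right_cts t : I t -> g s @[s --> t^'+] --> g t.
Proof.
move=> It; have [t0 tT] := ge0_in_I It; apply/cvg_ballP => e e0.
have /cvgrPdist_lt/(_ _ e0) := rlim_right_continuous (x := t) ndF.
move=> Ge; near=> s; rewrite /= ballE_extdist/=.
have ts : (t < s)%R by near: s; exact: nbhs_right_gt.
have sT : (s < T)%R by near: s; exact: nbhs_right_lt.
have Is : I s by rewrite /I/= in_itv/= sT (le_lt_trans t0).
apply: le_lt_trans (increment_limit It Is ts) _; rewrite lte_fin.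
apply: le_lt_trans (ler_norm _) _; rewrite distrC.
by near: s.
Unshelve. all: by end_near. Qed.

Let limit_left_limit t : I t -> exists x : X, g s @[s --> t^'-] --> x.
Proof.
move=> It; have [t0 tT] := ge0_in_I It.
have [x Hx] := left_limit It; exists x; apply/cvg_ballP => e e0.
move: Hx; set L := sup _ => Hx.
have supL : has_sup [set F r | r in `]-oo, t[].
  split; first by exists (F (t - 1)), (t - 1)%R => //=; rewrite in_itv/= ltrBlDr ltrDl.
  by exists C => _ [s _ <-]; have [_ /(_ s)/andP[]] := bF.
have [_ [s0 + <-] Ls] := sup_adherent e0 supL; rewrite /= in_itv/= => s0t.
near=> s; rewrite /= ballE_extdist/=.
have s0s : (s0 < s)%R by near: s; exact: nbhs_left_gt.
have st : (s < t)%R by near: s; exact: nbhs_left_lt.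
have s_gt0 : (0 < s)%R.
  by near: s; apply: nbhs_left_gt; move: It; rewrite /I/= in_itv/= => /andP[].
have Is : I s by rewrite /I/= in_itv/= s_gt0 (lt_trans st).
(* Through a good time [r] between [s] and [t], the terms [F r] cancel and [L - G s] remains, which
   is at most [L - F s0]. *)
have [r /andP[sr rt] Ar] := good_between (ltW s_gt0) st (ltW tT).
apply: le_lt_trans (extdist_triangle (gam r) _ _) _; rewrite [X in _ + X]extdist_sym.
apply: le_lt_trans (leeD (Hx r Ar rt) (g_gam Is Ar sr)) _.
rewrite -EFinD lte_fin.
have : (F s0 <= G s)%R by rewrite (le_trans _ (le_rlim _ ndF))// ndF// ltW.
rewrite -/L in Ls; move: Ls; lra.
Unshelve. all: by end_near. Qed.

Let Borel_limit : Borel_map I g.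
Proof.
have mI : measurable I by exact: measurable_itv.
(* Sets with measurable preimage form a sigma-algebra, so open sets suffice; by right continuity
   their preimages contain an interval to the right of each point. *)
suff : <<s (@open X) >> `<=` image_set_system I g measurable by move=> h B /h.
apply: smallest_sub.
  apply: sigma_algebra_image; split; first exact: measurable0.
  - by move=> A mA; exact: measurableD.
  - by move=> A mA; exact: bigcupT_measurable.
move=> U oU; rewrite /image_set_system/=; apply: right_open_measurable => t [It Ut].
have [t0 tT] := ge0_in_I It.
have : nbhs (g t) U by move: oU; rewrite openE => /(_ _ Ut).
move=> /(limit_right_cts It)[e /= e0 He].
exists (Num.min e (T - t))%R; first by rewrite lt_min e0 subr_gt0.
move=> s /andP[ts]; rewrite -ltrBlDl lt_min => /andP[se sT]; split.
  by rewrite /I/= in_itv/= (le_lt_trans t0 ts)/=; move: sT; rewrite ltrD2r.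
by apply: He => //=; rewrite distrC gtr0_norm ?subr_gt0.
Qed.

(** Every vertex is moved slightly to the right, to a time where [g'] agrees with [gam]. The tail is
    treated first and its vertices only move right, so choosing [r0] before [t1] keeps the chain
    increasing. The three errors [e / 3] come from moving [t0], from moving [t1] and from the
    tail. *)
Let polygonal_length_approx N' g' (a b : R) :
  `]a, b[%classic `<=` I -> mu.-negligible N' ->
  (forall t, `]a, b[%classic t -> ~ N' t -> g' t = gam t) ->
  forall (s : seq R) t0 e, path <%R t0 s -> [set` t0 :: s] `<=` `]a, b[%classic ->
  (0 < e)%R ->
  exists r0 s', [/\ path <%R r0 s', [set` r0 :: s'] `<=` `]a, b[%classic,
    (t0 < r0)%R, extdist (g t0) (g' r0) <= e%:E &
    polygonal_length extdist g (t0 :: s) <=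
    polygonal_length extdist g' (r0 :: s') + e%:E].
Proof.
move=> abI N'0 g'E.
have approx t c e : `]a, b[%classic t -> (t < c)%R -> (c <= b)%R -> (0 < e)%R ->
    exists r, [/\ (t < r < c)%R, `]a, b[%classic r & extdist (g t) (g' r) <= e%:E].
  move=> abt tc cb e0; have It := abI _ abt; move: (abt).
  rewrite /= in_itv/= => /andP[at_ tb].
  have tcT : (t < Num.min c T)%R by rewrite lt_min tc (ge0_in_I It).2.
  have [|r [/andP[tr rc] Ar N'r Fr]] := good_right N'0 It tcT _ e0.
    by rewrite ge_min lexx orbT.
  move: rc; rewrite lt_min => /andP[rc rT].
  have abr : `]a, b[%classic r.
    by rewrite /= in_itv/= (lt_trans at_ tr) (lt_le_trans rc).
  exists r; split => //; first by rewrite tr.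
  rewrite g'E//; apply: le_trans (g_gam It Ar tr) _; rewrite lee_fin; lra.
elim=> [|t1 s IH] t0 e /=.
  move=> _ sab e0; have abt : `]a, b[%classic t0 by apply: sab; rewrite /= inE.
  have [|r [/andP[tr rb] abr gr]] := approx t0 b e abt _ (lexx _) e0.
    by move: abt; rewrite /= in_itv/= => /andP[].
  exists r, [::]; split => //; first by move=> x /=; rewrite inE => /eqP ->.
  by rewrite /polygonal_length/= !big_ord0 add0e lee_fin ltW.
move=> /andP[t01 ps] sab e0; have e3 : (0 < e / 3)%R by rewrite divr_gt0.
have [|r1 [s' [pr sr t1r1 gr1 pl]]] := IH t1 _ ps _ e3.
  by move=> x xs; apply: sab => /=; rewrite inE xs orbT.
have abt0 : `]a, b[%classic t0 by apply: sab; rewrite /= inE eqxx.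
have abt1 : `]a, b[%classic t1 by apply: sab; rewrite /= !inE eqxx orbT.
have [|r0 [/andP[t0r0 r0t1] abr0 gr0]] := approx t0 t1 _ abt0 t01 _ e3.
  by move: abt1; rewrite /= in_itv/= => /andP[_ /ltW].
exists r0, (r1 :: s'); split => //.
- by rewrite /= pr (lt_trans r0t1).
- by move=> x /=; rewrite inE => /orP[/eqP ->//|]; exact: sr.
- by apply: le_trans gr0 _; rewrite lee_fin ler_pdivrMr//; lra.
rewrite !polygonal_length_cons.
have tri : extdist (g t0) (g t1) <=
    extdist (g' r0) (g' r1) + (e / 3)%:E + (e / 3)%:E.
  apply: le_trans (extdist_triangle (g' r1) _ _) _.
  rewrite [X in _ + X]extdist_sym leeD// addeC.
  by apply: le_trans (extdist_triangle (g' r0) _ _) _; rewrite leeD.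
apply: le_trans (leeD tri pl) _.
have -> : e%:E = (e / 3)%:E + (e / 3)%:E + (e / 3)%:E by rewrite -!EFinD; congr _%:E; lra.
rewrite -!addeA leeD2l// [leRHS]addeCA.
by rewrite leeD2l// addeCA lexx.
Qed.

Let ess_Var_limit (a b : R) : `]a, b[%classic `<=` I ->
  ess_Var extdist gam `]a, b[%classic = Var extdist g `]a, b[%classic.
Proof.
move=> abI; apply/eqP; rewrite eq_le; apply/andP; split.
  apply: ereal_inf_lbound; exists g => //.
  by apply: negligibleS ae_limit_eq => t /= h1 h2; apply: h1 => /abI.
apply: le_ereal_inf_tmp => _ [g' g'E <-].
apply: ge_ereal_sup => _ [[|t0 s] [ps sab] <-].
  by rewrite /polygonal_length/= big_ord0 Var_ge0.
apply/lee_addgt0Pr => e e0.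
have g'E' t : `]a, b[%classic t ->
    ~ (~` [set t | `]a, b[%classic t -> g' t = gam t]) t -> g' t = gam t.
  by move=> abt /contrapT; exact.
have [r0 [s' [pr sr _ _ pl]]] := polygonal_length_approx abI g'E g'E' ps sab e0.
by apply: le_trans pl _; rewrite leeD2r// polygonal_length_le_Var.
Qed.

Let bounded_monotone_limit : bounded_monotone G C.
Proof.
have [_ FC] := bF; split; first exact: rlim_nd.
move=> x; rewrite (le_trans (proj1 (andP (FC x))))/= ?le_rlim//.
have xx : (x < x + 1)%R by rewrite ltrDl.
by rewrite (le_trans (rlim_le ndF xx))//; have /andP[] := FC (x + 1)%R.
Qed.

Lemma cadlag_limit :
  [/\ Var extdist g I <= C%:E, representative I gam g, cadlag I g &
    forall a b : R, `]a, b[%classic `<=` I ->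
      ess_Var extdist gam `]a, b[%classic = Var extdist g `]a, b[%classic].
Proof.
split.
- exact: Var_le bounded_monotone_limit increment_limit.
- by split; [exact: Borel_limit|exact: ae_limit_eq].
- by split; [exact: limit_right_cts|exact: limit_left_limit].
- exact: ess_Var_limit.
Qed.

End properties.

Lemma exists_cadlag_representative : exists g : R -> X,
  [/\ Var extdist g I <= C%:E, representative I gam g, cadlag I g &
    forall a b : R, `]a, b[%classic `<=` I ->
      ess_Var extdist gam `]a, b[%classic = Var extdist g `]a, b[%classic].
Proof. by have [g Hg] := right_limit_curve; exists g; exact: cadlag_limit. Qed.

End cadlag_representative.

(** * The equivalences *)

Theorem theorem2p11 (R : realType) (X : extMetricType R) (T : R)
    (T_gt0 : (0 < T)%R) (gam : R -> X) (mgam : Borel_map `]0%R, T[%classic gam) :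
  let I : set R := `]0%R, T[%classic in
  let P1 := ess_Var_star extdist gam I < +oo in
  let P2 :=
    ereal_sup [set \int[lebesgue_measure]_(t in `]0%R, (T - h)%R[%classic)
                     (extdist (gam (t + h)%R) (gam t) * (h^-1)%:E)
              | h in `]0%R, T[%classic] < +oo in
  let P3 :=
    exists mu : {finite_measure set (measurableTypeR R) -> \bar R},
      forall phi : X -> R, Lip1 phi ->
        BV_function I (phi \o gam) /\
        derivative_variation_le I (phi \o gam) mu in
  let P4 :=
    exists mu : {finite_measure set (measurableTypeR R) -> \bar R},
      {ae (lebesgue_measure \x lebesgue_measure), forall p : R * R,
        I p.1 -> I p.2 -> (p.1 <= p.2)%R ->
        extdist (gam p.1) (gam p.2) <= mu `[p.1, p.2]%classic} in
  let P5 := ess_Var extdist gam I < +oo in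
  [<-> P1; P2; P3; P4] /\
  (seq_complete X ->
    [<-> P1; P2; P3; P4; P5] /\
    (P5 -> exists g : R -> X,
      [/\ representative I gam g, cadlag I g &
          forall a b : R, `]a, b[%classic `<=` I ->
            ess_Var extdist gam `]a, b[%classic = Var extdist g `]a, b[%classic])).
Proof.
move=> I P1 P2 P3 P4 P5.
have P1P : P1 <-> strong_bv T gam.
  exact: ess_Var_star_ltyP (@extdist_ge0 R X) gam I.
have P12 : P1 -> P2.
  move=> /P1P/strong_bv_difference_quotient[C HC].
  by apply: le_lt_trans (ltry C); apply: ge_ereal_sup => _ [h Ih <-]; exact: HC.
have P23 : P2 -> P3.
  move=> P2h; have [C HC] : exists C : R, forall h, I h ->
      \int[lebesgue_measure]_(t in `]0%R, (T - h)%R[%classic)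
        (extdist (gam (t + h)%R) (gam t) * (h^-1)%:E) <= C%:E.
    move: P2h; rewrite /P2; set S := ereal_sup _ => Soo.
    exists (fine S) => h Ih; apply: (@le_trans _ _ S).
      by apply: ereal_sup_ubound; exists h.
    by case: S Soo => //= _; rewrite leNye.
  (* Going through the strong bound gives one measure for all [phi], bounded or not. *)
  have [F [C' [bF [N N0 gF]]]] :=
    strong_bv_of_weak_bv (weak_bv_of_difference_quotients T_gt0 mgam HC).
  have [ndF FC] := bF; have [m mE] := exists_monotone_measure ndF FC.
  exists m => phi Lphi.
  have mphi : measurable_fun I (phi \o gam) by exact: measurable_Lip1_comp.
  have phiF : ae_increment_le real_dist (phi \o gam) I F.
    by exists N => // s t As At st; apply: le_trans (Lphi _ _) _; exact: gF.
  split; first exact: (BV_function_increment T_gt0 bF phiF).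
  exact: (derivative_variation_le_increment T_gt0 mphi bF phiF mE).
have P34 : P3 -> P4.
  move=> [m mP]; apply: strong_bv_product; apply: strong_bv_of_weak_bv => //.
  exists (distribution_function m), (fine (m setT)); split.
    exact: bounded_monotone_distribution_function.
  by move=> phi /mP[_ h] _; exact: derivative_variation_increment.
have P4S : P4 -> strong_bv T gam by move=> [m]; exact: product_strong_bv.
have P5S : P5 -> strong_bv T gam.
  move=> P5h; apply/P1P; apply: le_lt_trans P5h.
  apply: le_ereal_inf_tmp => _ [g gE <-].
  (* A full representative, restricted to the times where it agrees with [gam], competes in
     [ess_Var_star]. *)
  apply: (@le_trans _ _ (Var extdist g (I `&` [set t | g t = gam t]))).
    apply: ereal_inf_lbound; exists (I `&` [set t | g t = gam t]), g; split => //.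
    - by apply: negligibleS gE => t /= [It] /not_andP[//|gt] /(_ It).
    - by move=> t [].
  by apply: le_Var => t [].
split; first by do ![split] => // h; apply/P1P; exact: P4S.
move=> cX.
have cadlagP : strong_bv T gam -> exists (C : R) (g : R -> X),
    [/\ Var extdist g I <= C%:E, representative I gam g, cadlag I g &
      forall a b : R, `]a, b[%classic `<=` I ->
        ess_Var extdist gam `]a, b[%classic = Var extdist g `]a, b[%classic].
  move=> [F [C [bF [N N0 gF]]]]; exists C.
  exact: (exists_cadlag_representative cX bF N0 gF).
split; last by move=> /P5S/cadlagP[C [g [_ ? ? ?]]]; exists g.
have P45 : P4 -> P5.
  move=> /P4S/cadlagP[C [g [gC [_ gE] _ _]]]; apply: le_lt_trans (ltry C).
  by apply: le_trans gC; apply: ereal_inf_lbound; exists g.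
by do ![split] => // h; apply/P1P; exact: P5S.
Qed.
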